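(* Let $p(n)$ denote the number of partitions of $n$. For all integers $n>1$, \[ \frac{p(n-1)}{p(n)}\left(1+\frac{1}{n}\right) > \frac{p(n)}{p(n+1)}. \]
   Context: $p(n)$ is the partition function: the number of ways of writing $n$ as an unordered sum of positive integers. *)

(* Defs.v *)
From mathcomp Require Import all_boot all_order all_algebra.
Set Implicit Arguments. Unset Strict Implicit. Unset Printing Implicit Defensive.

Definition is_partition (n : nat) (s : seq nat) : bool :=
  [&& sorted geq s, all (fun x => 0 < x) s & sumn s == n].

Fixpoint bounded_seqs (k m : nat) : seq (seq nat) :=
  match k with
  | 0 => [:: [::]]
  | k'.+1 => [seq x :: s | x <- iota 0 m.+1, s <- bounded_seqs k' m]
  end.

(* Every partition of n has length <= n and parts <= n, so it occurs exactly once
   in the candidate list below; p n is the number of partitions of n. *)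
Definition candidates (n : nat) : seq (seq nat) :=
  flatten [seq bounded_seqs k n | k <- iota 0 n.+1].

Definition p (n : nat) : nat := count (is_partition n) (candidates n).

(* Main.v *)
Require Import Defs.
From Stdlib Require Import BinInt.
From mathcomp Require Import all_boot all_order all_algebra.
From mathcomp Require Import zify ssrZ ring lra.
Set Implicit Arguments. Unset Strict Implicit. Unset Printing Implicit Defensive.
Import Order.TTheory GRing.Theory Num.Theory.

(** Write [d = p(n) - p(n-1)] and [h = p / d].  The sixth difference of [p] is eventually
    nonnegative, so on the scale of [sqrt n] the function [p] is a mixture of shifted fifth powers
    [(t - l)_+^5]; as for such mixtures, [h] grows with slope at most [1/5].  If the inequality
    fails at [n], this slope bound forces [h(n)] to be at most about [sqrt (n / 5)], and applied once
    more it makes [p] grow so fast between [n] and [N = n + O(sqrt n)] that the right-hand side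
    of [N p(N) = sum_(a, b >= 1) b p(N - a b)] is smaller than its left-hand side.  This argument
    works for [n >= 1021]; smaller [n] are checked by computation. *)

(** * Partitions and generating functions *)

(** The slope bound acts forward only: a bound on [h(n)] bounds [h(m)] for [m >= n] and says nothing
    below [n]. This is why the contradiction is sought at some [N > n]. Between [n] and [N] the
    growth of [p] is controlled. Below [n] crude estimates suffice, since [p(n) / p(N)] is by then
    at most [(3/5)^5]. There is room for losses: asymptotically [h(n)] is [sqrt (6 n) / pi], about
    [0.78 sqrt n], while a failure would force about [0.45 sqrt n].

    The numbers six and five belong together. With a nonnegative sixth difference, the relation
    [(mu - 1) a'^2 <= mu a a''] is trivial for the fourth difference at [mu = 1], and each step back
    to a lower difference raises [mu] by one, ending with [mu = 5] for [p] itself.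

    The obstacle is that [(1-x)^6 / prod_k (1-x^k)] has infinitely many factors. Nonnegativity from
    some index on survives division by [1 - x^k] once it is checked on [k] consecutive coefficients,
    so finitely many factors reduce to a finite computation; the others are handled together by
    bounding the damage that the early negative coefficients can do. *)

Lemma mem_bounded_seqs k m s :
  (s \in bounded_seqs k m) = (size s == k) && all (fun x => x <= m) s.
Proof.
elim: k s => [|k IH] s; first by rewrite inE; case: s.
apply/allpairsPdep/andP => [[x [t []]]|[]].
  rewrite mem_iota IH add0n ltnS => /andP[_ xm] /andP[/eqP st at_] ->.
  by rewrite /= st eqxx xm at_.
case: s => [//|x s] /= /eqP[ss] /andP[xm as_].
exists x, s; split=> //; first by change (x \in iota 0 m.+1); rewrite mem_iota.
by rewrite IH ss eqxx.
Qed.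

Lemma uniq_bounded_seqs k m : uniq (bounded_seqs k m).
Proof.
elim: k => [//|k IH]; apply: allpairs_uniq => //; first exact: iota_uniq.
by move=> [x s] [y t] _ _ /= [-> ->].
Qed.

Lemma mem_candidates n s :
  (s \in candidates n) = (size s <= n) && all (fun x => x <= n) s.
Proof.
apply/flattenP/andP => [[l /mapP[k]]|[sn sa]].
  rewrite mem_iota add0n ltnS => /andP[_ kn] ->.
  by rewrite mem_bounded_seqs => /andP[/eqP -> ->].
exists (bounded_seqs (size s) n); last by rewrite mem_bounded_seqs eqxx.
by apply/mapP; exists (size s); rewrite // mem_iota add0n ltnS.
Qed.

Lemma uniq_candidates n : uniq (candidates n).
Proof.
rewrite /candidates; have := iota_uniq 0 n.+1.
elim: (iota 0 n.+1) => [//|k r IH] /= /andP[kr ur].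
rewrite cat_uniq uniq_bounded_seqs IH //= andbT; apply/hasPn => s.
move=> /flattenP[l /mapP[j jr ->]]; rewrite mem_bounded_seqs => /andP[/eqP sj _].
by apply/negP; rewrite /= mem_bounded_seqs => /andP[/eqP sk _]; rewrite -sk sj jr in kr.
Qed.

(** The fuel [f] bounds [m + n], which drops in both calls. Splitting by whether the part [m] occurs
    is the recurrence for division by [1 - x^m]. *)
Fixpoint parts_upto (f m n : nat) : seq (seq nat) :=
  match f, m with
  | f'.+1, m'.+1 => parts_upto f' m' n ++
      (if m <= n then [seq m :: s | s <- parts_upto f' m (n - m)] else [::])
  | _, _ => if n == 0 then [:: [::]] else [::]
  end.

(** In a nonincreasing list the head bounds every part; the default 0 admits the empty partition for
    every [m]. *)
Lemma mem_parts_upto f m n s : m + n <= f ->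
  (s \in parts_upto f m n) = is_partition n s && (head 0 s <= m).
Proof.
have base k t : (t \in (if k == 0 then [:: [::]] else [::])) =
    is_partition k t && (head 0 t <= 0).
  rewrite /is_partition; case: t => [|x t] /=; first by case: k.
  case: eqP => _; rewrite ?inE /=; first by case: x => [|x]; rewrite /= ?andbF.
  by case: x => [|x]; rewrite /= ?andbF.
elim: f m n s => [|f IH] m n s mnf.
  by move: mnf; rewrite leqn0 addn_eq0 => /andP[/eqP -> /eqP ->]; exact: (base 0 s).
case: m mnf => [|m] mnf; first exact: (base n s).
rewrite /= mem_cat IH; last by lia.
case: (leqP m.+1 n) => mn; last first.
  rewrite in_nil orbF; case: s => [|x s] //=.
  case: (boolP (is_partition _ _)) => //= /and3P[_ _ /eqP /= sm]; lia.
case: s => [|x s].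
  rewrite /=; have -> : (([::] : seq nat) \in [seq m.+1 :: s | s <- parts_upto f m.+1 (n - m.+1)]) = false.
    by apply/negP => /mapP[].
  by rewrite orbF.
have -> : (x :: s \in [seq m.+1 :: s | s <- parts_upto f m.+1 (n - m.+1)]) =
   (x == m.+1) && (s \in parts_upto f m.+1 (n - m.+1)).
  apply/mapP/andP => [[t tp [-> ->]]|[/eqP -> sp]]; first by rewrite eqxx.
  by exists s.
rewrite IH; last by lia.
rewrite /is_partition /=; case: (ltngtP x m.+1) => xm /=.
- by rewrite orbF; have -> : x <= m by lia.
- by rewrite andbF orbF; apply/andP => -[_]; lia.
rewrite xm; have -> : m.+1 <= m = false by lia.
rewrite andbF /=.
have -> : (m.+1 + sumn s == n) = (sumn s == n - m.+1) by lia.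
case: s => [|y s] /=; first by rewrite !andbT.
rewrite /geq /=; case: (leqP y m.+1) => ym /=; rewrite ?andbT ?andbF //.
Qed.

Lemma uniq_parts_upto f m n : m + n <= f -> uniq (parts_upto f m n).
Proof.
elim: f m n => [|f IH] m n mnf; first by rewrite /=; case: ifP.
case: m mnf => [|m] mnf /=; first by case: ifP.
rewrite cat_uniq IH; last by lia.
case: (leqP m.+1 n) => mn //=; rewrite map_inj_uniq ?IH; [| lia| by move=> ? ? []].
rewrite andbT; apply/hasPn => s /mapP[t _ ->] /=.
by apply/negP; rewrite mem_parts_upto /= ?ltnn ?andbF //; lia.
Qed.

Lemma p_size_parts_upto f n : n + n <= f -> p n = size (parts_upto f n n).
Proof.
move=> nf; rewrite /p -size_filter; apply: perm_size.
apply: uniq_perm; rewrite ?filter_uniq ?uniq_candidates ?uniq_parts_upto // => s.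
rewrite mem_filter mem_candidates mem_parts_upto //.
case: (boolP (is_partition n s)) => //= /and3P[so po /eqP sn].
have le_sumn : all (fun x => x <= n) s.
  apply/allP => x xs; rewrite -sn; elim: {so po sn} s xs => //= y s IH.
  by rewrite inE => /orP[/eqP ->|/IH]; lia.
have le_size : size s <= n.
  rewrite -sn; elim: {so sn le_sumn} s po => //= y s IH /andP[y0 /IH]; lia.
rewrite le_size le_sumn; symmetry; case: s {so po sn le_size} le_sumn => //= x s /andP[] //.
Qed.

(** * Division of power series by [1 - x^k] *)

Local Open Scope ring_scope.

(* [psum k u] is the power series [u] divided by [1 - x^k], and [bdiff k u] is
   the product of [u] with [1 - x^k]. *)
Definition bdiff (k : nat) (u : nat -> int) (n : nat) : int :=
  u n - (if (k <= n)%N then u (n - k)%N else 0).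

Fixpoint psum_rec (f k : nat) (u : nat -> int) (n : nat) : int :=
  u n + (if f is f'.+1 then
           if (k <= n)%N then psum_rec f' k u (n - k)%N else 0 else 0).

Definition psum (k : nat) (u : nat -> int) (n : nat) : int := psum_rec n k u n.

Lemma psum_rec_fuel f g k u n : (0 < k)%N -> (n <= f)%N -> (n <= g)%N ->
  psum_rec f k u n = psum_rec g k u n.
Proof.
move=> k0; elim: f g n => [|f IH] [|g] n nf ng //=; congr (_ + _); case: ifP => // kn; try lia.
by apply: IH; lia.
Qed.

Lemma psumE k u n : (0 < k)%N ->
  psum k u n = u n + (if (k <= n)%N then psum k u (n - k)%N else 0).
Proof.
move=> k0; rewrite /psum; case: n => [|n] /=; first by case: ifP => //; lia.
by congr (_ + _); case: ifP => // kn; apply: psum_rec_fuel; lia.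
Qed.

Lemma psum_unique k u v : (0 < k)%N ->
  (forall n, v n = u n + (if (k <= n)%N then v (n - k)%N else 0)) -> v =1 psum k u.
Proof.
move=> k0 vE n; elim/ltn_ind: n => n IH; rewrite vE psumE //.
by congr (_ + _); case: ifP => // kn; apply: IH; lia.
Qed.

Lemma eq_psum k u v : (0 < k)%N -> u =1 v -> psum k u =1 psum k v.
Proof. by move=> k0 uv; apply: psum_unique => // n; rewrite psumE // uv. Qed.

Lemma eq_bdiff k u v : u =1 v -> bdiff k u =1 bdiff k v.
Proof. by move=> uv n; rewrite /bdiff !uv. Qed.

Lemma bdiffK k u : (0 < k)%N -> psum k (bdiff k u) =1 u.
Proof.
move=> k0 n; symmetry; apply: (psum_unique (u := bdiff k u)) => // i.
by rewrite /bdiff subrK.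
Qed.

Lemma psumK k u : (0 < k)%N -> bdiff k (psum k u) =1 u.
Proof. by move=> k0 n; rewrite /bdiff psumE // addrK. Qed.

Lemma bdiffC j k u : bdiff j (bdiff k u) =1 bdiff k (bdiff j u).
Proof.
move=> n; rewrite /bdiff.
case: (leqP j n) => jn; case: (leqP k n) => kn; rewrite ?subr0.
- have -> : (k <= n - j)%N = (j <= n - k)%N by lia.
  by rewrite subnAC; case: ifP => _; ring.
- have -> : (k <= n - j)%N = false by lia.
  by ring.
- have -> : (j <= n - k)%N = false by lia.
  by ring.
by [].
Qed.

Lemma bdiff_psumC j k u : (0 < k)%N -> bdiff j (psum k u) =1 psum k (bdiff j u).
Proof.
move=> k0 n; rewrite -(bdiffK (bdiff j (psum k u)) k0).
by apply: eq_psum => // i; rewrite bdiffC; apply: eq_bdiff => l; apply: psumK.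
Qed.

Lemma psumC j k u : (0 < j)%N -> (0 < k)%N -> psum j (psum k u) =1 psum k (psum j u).
Proof.
move=> j0 k0 n; rewrite -(bdiffK (psum j (psum k u)) k0).
by apply: eq_psum => // i; rewrite bdiff_psumC //; apply: eq_psum => // l; apply: psumK.
Qed.

Definition delta0 (n : nat) : int := (n == 0)%N%:R.

Definition psums (ks : seq nat) (u : nat -> int) : nat -> int := foldr psum u ks.

Lemma eq_psums ks u v : all (leq 1) ks -> u =1 v -> psums ks u =1 psums ks v.
Proof.
by elim: ks => [|k ks IH] //= /andP[k0 ks0] uv; apply: eq_psum => //; apply: IH.
Qed.

Lemma psums_cat ks ls u : psums (ks ++ ls) u = psums ks (psums ls u).
Proof. by rewrite /psums foldr_cat. Qed.

Lemma bdiff_psumsC j ks u : all (leq 1) ks ->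
  bdiff j (psums ks u) =1 psums ks (bdiff j u).
Proof.
elim: ks => [|k ks IH] //= /andP[k0 ks0] n.
by rewrite bdiff_psumC //; apply: eq_psum => //; apply: IH.
Qed.

Lemma psum_psumsC j ks u : (0 < j)%N -> all (leq 1) ks ->
  psum j (psums ks u) =1 psums ks (psum j u).
Proof.
move=> j0; elim: ks => [|k ks IH] //= /andP[k0 ks0] n.
by rewrite psumC //; apply: eq_psum => //; apply: IH.
Qed.

Lemma psums_perm ks ls u : all (leq 1) ks -> perm_eq ks ls ->
  psums ks u =1 psums ls u.
Proof.
elim: ks ls u => [|k ks IH] ls u; first by rewrite perm_sym => _ /perm_nilP ->.
move=> /= /andP[k0 ks0] pkl n.
have kl : k \in ls by rewrite -(perm_mem pkl) mem_head.
case: (path.splitP kl) pkl => l1 l2 pkl.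
have p2 : perm_eq ks (l1 ++ l2).
  by rewrite -(perm_cons k) (perm_trans pkl) // -cats1 -catA perm_catCA.
have : all (leq 1) (l1 ++ l2) by rewrite -(perm_all _ p2).
rewrite all_cat => /andP[a1 a2].
rewrite cat_rcons psums_cat /= -psum_psumsC // -psums_cat.
by apply: eq_psum => //; apply: IH.
Qed.

Definition pparts (m : nat) : nat -> int := psums (rev (iota 1 m)) delta0.

Lemma ppartsS m : pparts m.+1 = psum m.+1 (pparts m).
Proof.
rewrite /pparts; have -> : iota 1 m.+1 = iota 1 m ++ [:: m.+1].
  by rewrite -[in LHS](addn1 m) iotaD.
by rewrite rev_cat.
Qed.

Lemma pparts_size f m n : (m + n <= f)%N ->
  (size (parts_upto f m n))%:Z = pparts m n.
Proof.
elim: f m n => [|f IH] m n mnf.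
  by move: mnf; rewrite leqn0 addn_eq0 => /andP[/eqP -> /eqP ->].
case: m mnf => [|m] mnf; first by rewrite /= /pparts /= /delta0; case: eqP.
rewrite ppartsS psumE //= size_cat PoszD IH ?addrA; last by lia.
congr (_ + _); case: ifP => // mn; rewrite size_map IH; last by lia.
by rewrite ppartsS.
Qed.

Lemma pparts_widen m n : (n <= m)%N -> pparts m n = (p n)%:Z.
Proof.
move=> nm; rewrite -(subnKC nm); elim: (m - n)%N => [|j IH].
  by rewrite addn0 (@p_size_parts_upto (n + n)%N) ?pparts_size.
by rewrite addnS ppartsS psumE //; case: ifP => [|_]; [lia|rewrite addr0].
Qed.

Lemma psum_sum k u n M : (0 < k)%N -> (n < M)%N ->
  psum k u n = \sum_(0 <= a < M | (a * k <= n)%N) u (n - a * k)%N.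
Proof.
move=> k0; elim: M n => [//|M IH] n nM.
rewrite psumE // big_mkcond big_nat_recl //= mul0n subn0; congr (_ + _).
case: (leqP k n) => kn; last first.
  by rewrite big1_seq // => a _; rewrite ifF //; nia.
rewrite IH; last by lia.
rewrite [LHS]big_mkcond; apply: eq_bigr => a _ /=.
have -> : (a.+1 * k <= n)%N = (a * k <= n - k)%N by lia.
by have -> : (n - a.+1 * k)%N = (n - k - a * k)%N by lia.
Qed.

(** Logarithmic derivative: for [F = prod_(b <= m) 1 / (1 - x^b)] one has
    [x F' = F * sum_b b x^b / (1 - x^b)]. Subtracting [pparts m n] removes the constant term of
    [1 / (1 - x^b)]. *)
Lemma pparts_weighted_sum m n : n%:Z * pparts m n =
  \sum_(1 <= b < m.+1) b%:Z * (psum b (pparts m) n - pparts m n).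
Proof.
elim: m n => [|m IHm] n.
  by rewrite big_geq // /pparts /= /delta0; case: n => [|n] /=; ring.
elim/ltn_ind: n => n IHn; rewrite big_nat_recr //=.
set v := pparts m.+1; set u := pparts m in IHm *; set c := m.+1.
have vE i : v i = u i + (if (c <= i)%N then v (i - c)%N else 0).
  by rewrite /v ppartsS psumE.
have bvE b : (0 < b)%N ->
    psum b v n = psum b u n + (if (c <= n)%N then psum b v (n - c)%N else 0).
  move=> b0; have E i : psum b v i = psum c (psum b u) i.
    by rewrite /v ppartsS psumC.
  by rewrite !E psumE.
have -> : \sum_(1 <= i < c) i%:Z * (psum i v n - v n) = n%:Z * u n +
    (if (c <= n)%N then \sum_(1 <= i < c) i%:Z * (psum i v (n - c) - v (n - c)%N) else 0).
  rewrite IHm; case: (leqP c n) => cn.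
    rewrite -big_split /=; apply: eq_big_nat => b /andP[b1 _].
    by rewrite bvE // [v n]vE cn; ring.
  rewrite addr0; apply: eq_big_nat => b /andP[b1 _].
  by rewrite bvE // [v n]vE leqNgt cn /= !addr0.
rewrite [psum c v n]psumE //; case: (leqP c n) => cn; last first.
  by rewrite [v n]vE leqNgt cn /=; ring.
have := IHn (n - c)%N; rewrite -/v big_nat_recr //= -/c => IHc.
set S := (X in _ = _ * _ + X + _) in IHc *.
have {}IHc : (n - c)%N%:Z * v (n - c)%N = S + c%:Z * (psum c v (n - c) - v (n - c)%N).
  by apply: IHc; lia.
rewrite [v n]vE cn mulrDr.
have -> : n%:Z = (n - c)%N%:Z + c%:Z by lia.
rewrite [X in _ + X = _]mulrDl IHc; ring.
Qed.

Lemma p_weighted_sum n : n%:Z * (p n)%:Z =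
  \sum_(1 <= a < n.+1) \sum_(1 <= b < n.+1 | (a * b <= n)%N) b%:Z * (p (n - a * b))%:Z.
Proof.
rewrite -(pparts_widen (leqnn n)) pparts_weighted_sum.
under [RHS]eq_bigr => a _ do rewrite big_mkcond.
rewrite [RHS]exchange_big /=; apply: eq_big_nat => b /andP[b1 _].
rewrite (@psum_sum b _ n n.+1) // big_mkcond big_nat_recl //= mul0n subn0 [X in _ * X]addrC addKr.
rewrite big_distrr big_add1 /=; apply: eq_bigr => a _.
by case: ifP => //= _; rewrite ?mulr0 ?pparts_widen //; lia.
Qed.

Lemma psum_ge0 k u : (0 < k)%N -> (forall i, 0 <= u i) -> forall i, 0 <= psum k u i.
Proof.
move=> k0 u0 i; rewrite (@psum_sum k _ i i.+1) //; apply: sumr_ge0 => a _; exact: u0.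
Qed.

Lemma psums_ge0 ks u : all (leq 1) ks -> (forall i, 0 <= u i) ->
  forall i, 0 <= psums ks u i.
Proof.
by elim: ks => [|k ks IH] //= /andP[k0 ks0] u0; apply: psum_ge0 => //; apply: IH.
Qed.

Lemma all_rev_iota1 m : all (leq 1) (rev (iota 1 m)).
Proof. by rewrite all_rev; apply/allP => i; rewrite mem_iota => /andP[]. Qed.

(** Multiplication by [1 - x] cancels the factor of the part 1, and the remaining product over parts
    at least 2 has nonnegative coefficients. *)
Lemma leq_pS n : (p n <= p n.+1)%N.
Proof.
have K : bdiff 1 (pparts n.+1) n.+1 >= 0.
  have -> : pparts n.+1 = psums (rev (iota 2 n)) (psum 1 delta0).
    by rewrite /pparts /= rev_cons -cats1 psums_cat.
  have a2 : all (leq 1) (rev (iota 2 n)).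
    by rewrite all_rev; apply/allP => i; rewrite mem_iota; lia.
  rewrite bdiff_psumsC //; apply: psums_ge0 => // i.
  by rewrite psumK // /delta0 ler0n.
move: K; rewrite /bdiff /= subn1 /= !pparts_widen //; lia.
Qed.

Lemma leq_p : {homo p : i j / (i <= j)%N}.
Proof. exact: (homo_leq (@leqnn) leq_trans leq_pS). Qed.

Lemma p_gt0 n : (0 < p n)%N.
Proof.
have -> : 0%N.+1 = p 0 by apply/eqP.
exact: leq_p.
Qed.

(** * Nonnegativity of the sixth difference *)

(* The queue [front ++ rev back] holds the last [k] outputs. *)
Fixpoint lsum_rec (front back l : seq Z) : seq Z :=
  if l is x :: l' then
    if front is y :: f then
      let z := Z.add x y in z :: lsum_rec f (z :: back) l'
    else if catrev back [::] is y :: f then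
      let z := Z.add x y in z :: lsum_rec f [:: z] l'
    else [::]
  else [::].

Definition lsum (k : nat) (l : seq Z) : seq Z := lsum_rec (nseq k Z0) [::] l.

Definition tabZ (u : nat -> int) (n : nat) : seq Z :=
  [seq Z_of_int (u i) | i <- iota 0 n].

Lemma size_tabZ u n : size (tabZ u n) = n.
Proof. by rewrite size_map size_iota. Qed.

Lemma nth_tabZ u n i : (i < n)%N -> nth Z0 (tabZ u n) i = Z_of_int (u i).
Proof. by move=> lin; rewrite /tabZ (nth_map 0%N) ?size_iota // nth_iota. Qed.

Lemma eq_tabZ u v n : u =1 v -> tabZ u n = tabZ v n.
Proof. by move=> uv; apply: eq_map => i; rewrite uv. Qed.

Lemma take_tabZ u m n : (m <= n)%N -> take m (tabZ u n) = tabZ u m.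
Proof. by move=> mn; rewrite /tabZ -map_take take_iota (minn_idPl mn). Qed.

Lemma lsum_tabZ k u n : (0 < k)%N -> lsum k (tabZ u n) = tabZ (psum k u) n.
Proof.
move=> k0; pose V j := Z_of_int (psum k u j).
pose W j := if (k <= j)%N then V (j - k)%N else Z0.
have VE j : V j = Z.add (Z_of_int (u j)) (W j).
  by rewrite /W /V psumE //; case: ifP => _; lia.
suff gen i f b : f ++ rev b = [seq W j | j <- iota i k] ->
    lsum_rec f b [seq Z_of_int (u j) | j <- iota i n] = [seq V j | j <- iota i n].
  apply: gen; rewrite cats0; apply: (@eq_from_nth _ Z0) => [|j].
    by rewrite size_nseq size_map size_iota.
  rewrite size_nseq => jk; rewrite nth_nseq jk (nth_map 0%N) ?size_iota //.
  by rewrite nth_iota // /W ifF //; lia.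
elim: n i f b => [//|n IH] i f b qE /=.
have stepE y f' b' : (y :: f') ++ rev b' = [seq W j | j <- iota i k] ->
    Z.add (Z_of_int (u i)) y :: lsum_rec f' (Z.add (Z_of_int (u i)) y :: b')
      [seq Z_of_int (u j) | j <- iota i.+1 n] = V i :: [seq V j | j <- iota i.+1 n].
  move=> q'; have kk : k = k.-1.+1 by lia.
  rewrite kk /= in q'; case: q' => -> q'.
  rewrite -VE IH //; rewrite rev_cons -cats1 catA q' kk -[in RHS](addn1 k.-1) iotaD map_cat /=.
  by rewrite /W addSnnS -kk leq_addl addnK.
case: f qE => [|y f] qE; last exact: stepE.
rewrite -/(rev b); case E : (rev b) qE => [|y f] qE.
  by move/(congr1 size): qE; rewrite /= size_map size_iota => k00; rewrite -k00 in k0.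
by apply: (stepE _ _ [::]); rewrite cats0.
Qed.

Definition ldiff (k : nat) (l : seq Z) : seq Z :=
  [seq Z.sub x.1 x.2 | x <- zip l (ncons k Z0 l)].

Lemma ldiff_tabZ k u n : ldiff k (tabZ u n) = tabZ (bdiff k u) n.
Proof.
have sz : size (zip (tabZ u n) (ncons k Z0 (tabZ u n))) = n.
  by rewrite size_zip size_ncons size_tabZ; lia.
apply: (@eq_from_nth _ Z0); rewrite size_map sz ?size_tabZ // => i lin.
rewrite (nth_map (Z0, Z0)) ?sz // nth_zip_cond sz lin /= nth_ncons.
rewrite !(nth_tabZ _ lin) nth_tabZ /bdiff; last by lia.
by case: (ltnP i k) => ik; lia.
Qed.

(** From [n] on, each value is the value [k] places earlier plus an increment in [Q], so one window
    of length [k] decides all later values. Keeping [R] apart from [Q] allows a positive lower bound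
    to be propagated by nonnegative increments. *)
Lemma psum_window k u n (Q R : int -> Prop) : (0 < k)%N -> (k <= n)%N ->
  (forall x y, Q x -> R y -> R (x + y)) ->
  (forall i, (n <= i)%N -> Q (u i)) ->
  (forall i, (n - k <= i < n)%N -> R (psum k u i)) ->
  forall i, (n - k <= i)%N -> R (psum k u i).
Proof.
move=> k0 kn QR Qu Rw; elim/ltn_ind => i IH ni.
case: (ltnP i n) => lin; first by apply: Rw; rewrite ni.
rewrite psumE // (leq_trans kn lin); apply: QR; first exact: Qu.
by apply: IH; lia.
Qed.

Lemma all_drop_tabZ (chk : pred Z) u m n : all chk (drop m (tabZ u n)) ->
  forall i, (m <= i < n)%N -> chk (Z_of_int (u i)).
Proof.
move=> /all_nthP - /(_ Z0) H i /andP[mi lin].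
have := H (i - m)%N; rewrite size_drop size_tabZ nth_drop subnKC // nth_tabZ //.
by apply; lia.
Qed.

Fixpoint lsums_check (chk : pred Z) (ks : seq nat) (l : seq Z) : option (seq Z) :=
  if ks is k :: ks' then
    let l' := lsum k l in
    if all chk (drop (size l - k) l') then lsums_check chk ks' l' else None
  else Some l.

Lemma lsums_checkP (chk : pred Z) (Q : int -> Prop) ks u n l :
  (forall x y, Q x -> Q y -> Q (x + y)) ->
  (forall x, chk (Z_of_int x) -> Q x) ->
  all (fun k => (0 < k <= n)%N) ks ->
  (forall i, (n <= i)%N -> Q (u i)) ->
  lsums_check chk ks (tabZ u n) = Some l ->
  l = tabZ (psums (rev ks) u) n /\
  (forall i, (n <= i)%N -> Q (psums (rev ks) u i)).
Proof.
move=> Qadd chkQ; elim: ks u => [|k ks IH] u.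
  by move=> _ Qu [<-].
move=> /= /andP[/andP[k0 kn] ksn] Qu; rewrite lsum_tabZ // size_tabZ.
case: ifP => // /all_drop_tabZ win /IH.
rewrite rev_cons -cats1 psums_cat /=; apply=> // i ni.
apply: (psum_window k0 kn Qadd Qu); last by lia.
by move=> j jn; apply: chkQ; apply: win.
Qed.

Definition bdiff6 : (nat -> int) -> nat -> int := iter 6 (bdiff 1).

Lemma bdiff6_psumC k u : (0 < k)%N -> bdiff6 (psum k u) =1 psum k (bdiff6 u).
Proof.
move=> k0; rewrite /bdiff6; elim: 6%N => [//|j IH] n /=.
by rewrite -bdiff_psumC //; apply: eq_bdiff.
Qed.

Lemma bdiff6_psumsC ks u : all (leq 1) ks -> bdiff6 (psums ks u) =1 psums ks (bdiff6 u).
Proof.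
elim: ks => [//|k ks IH] /= /andP[k0 ks0] n.
by rewrite bdiff6_psumC //; apply: eq_psum => //; apply: IH.
Qed.

(* For [K = base_parts] and [L = 1260] the product [(1-x)^6 (1-x^L)^8 / prod_(k in K) (1-x^k)]
   is a polynomial, because all elements of [K] divide [L] and [#|K| - 6 = 8].  At most five
   elements of [K] are divisible by a given prime, so the pole at [1] of
   [(1-x)^6 / prod_(k in K) (1-x^k)] dominates and its coefficients are eventually positive. *)
Definition base_parts : seq nat := [:: 1; 2; 3; 4; 5; 7; 9; 10; 14; 15; 21; 28; 35; 45]%N.

Definition base_period : nat := (35 * 36)%N.

(** One more than the degree of [(1-x)^6 (1-x^L)^8], so that the list holds the whole polynomial. *)
Definition base_length : nat := (base_period * 8 + 7)%N.

Definition base_list : seq Z :=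
  iter 8 (ldiff base_period) (iter 6 (ldiff 1) (Z.one :: nseq base_length.-1 Z0)).

Definition next_parts : seq nat := [:: 11; 13; 17]%N.

Definition last_parts : seq nat :=
  [seq k <- iota 1 260 | k \notin base_parts ++ next_parts].

Definition neg_part_sum (l : seq Z) : Z := foldr (fun x s => Z.add (Z.max Z0 (Z.opp x)) s) Z0 l.

(** Once nonnegativity is known from some index on, the list can be cut there; the divisions by 11,
    13, 17 bring this index down to 560, so that the many divisions by [last_parts] run on a short
    list. The part 261 comes last because its windows must stay above the total of the negative
    coefficients below 262, not merely above 0. *)
Definition bdiff6_tail_check (l2 : seq Z) : bool :=
  all (Z.leb Z0) (drop (37 * 80) l2) &&
  if lsums_check (Z.leb Z0) next_parts (take (37 * 80) l2) is Some l3 then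
  all (Z.leb Z0) (drop 560 l3) &&
  if lsums_check (Z.leb Z0) last_parts (take 560 l3) is Some l4 then
  let l5 := lsum 261 l4 in
  all (Z.leb (neg_part_sum (take 262 l5))) (drop 262 l5)
  else false else false.

(** Windows of zeros certify that the division by [base_parts] ends in a polynomial. The eight
    divisions by [1 - x^L] then undo the auxiliary factor, and their windows give nonnegativity
    beyond the list. *)
Definition bdiff6_check : bool :=
  if lsums_check (Z.eqb Z0) base_parts base_list is Some l1 then
  if lsums_check (Z.leb Z0) (nseq 8 base_period) l1 is Some l2 then
  bdiff6_tail_check l2 else false else false.

Lemma bdiff6_check_true : bdiff6_check.
Proof. by vm_cast_no_check (erefl true). Qed.

Lemma perm_all_parts :
  perm_eq (261 :: rev last_parts ++ rev next_parts ++ rev base_parts)%N (rev (iota 1 261)).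
Proof.
rewrite -(perm_sort leq).
have -> : sort leq (261 :: rev last_parts ++ rev next_parts ++ rev base_parts)%N = iota 1 261.
  by vm_cast_no_check (erefl (iota 1 261)).
by rewrite perm_sym perm_rev.
Qed.

Lemma iter_bdiff_psumsC j k ks u : all (leq 1) ks ->
  psums ks (iter j (bdiff k) u) =1 iter j (bdiff k) (psums ks u).
Proof.
move=> ks0; elim: j => [//|j IH] n /=.
by rewrite -bdiff_psumsC //; apply: eq_bdiff.
Qed.

Lemma iter_bdiffK j k u : (0 < k)%N -> psums (nseq j k) (iter j (bdiff k) u) =1 u.
Proof.
move=> k0; elim: j => [//|j IH] n.
rewrite -[RHS]IH [RHS](_ : _ = psums (nseq j k) (psum k (iter j.+1 (bdiff k) u)) n).
  by rewrite -psum_psumsC //; apply/allP => x /nseqP[-> _].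
apply: eq_psums => [|i]; first by apply/allP => x /nseqP[-> _].
by rewrite /= bdiffK.
Qed.

Lemma bdiff_eq0 k u n : (forall i, (n <= i)%N -> u i = 0) ->
  forall i, (n + k <= i)%N -> bdiff k u i = 0.
Proof.
move=> u0 i ni; rewrite /bdiff u0; last by lia.
by case: ifP => // _; rewrite ?u0 ?subr0 //; lia.
Qed.

Lemma iter_bdiff_eq0 j k u n : (forall i, (n <= i)%N -> u i = 0) ->
  forall i, (n + k * j <= i)%N -> iter j (bdiff k) u i = 0.
Proof.
move=> u0; elim: j => [|j IH] i; first by rewrite muln0 addn0; apply: u0.
by rewrite mulnS addnCA addnC => ni; apply: bdiff_eq0 ni.
Qed.

Lemma iter_ldiff_tabZ j k u n : iter j (ldiff k) (tabZ u n) = tabZ (iter j (bdiff k) u) n.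
Proof. by elim: j => [//|j IH] /=; rewrite IH ldiff_tabZ. Qed.

Lemma tabZ_delta0 n : Z.one :: nseq n Z0 = tabZ delta0 n.+1.
Proof.
rewrite /tabZ /=; congr (_ :: _); apply: (@eq_from_nth _ Z0).
  by rewrite size_nseq size_map size_iota.
move=> i; rewrite size_nseq => lin.
by rewrite nth_nseq lin (nth_map 0%N) ?size_iota // nth_iota.
Qed.

Definition base_seq : nat -> int := iter 8 (bdiff base_period) (bdiff6 delta0).

Lemma base_list_tabZ : base_list = tabZ base_seq base_length.
Proof.
rewrite /base_list tabZ_delta0 !iter_ldiff_tabZ.
by congr tabZ; rewrite /base_length addnS.
Qed.

Lemma base_seq_eq0 i : (base_length <= i)%N -> base_seq i = 0.
Proof.
rewrite /base_length addnC => ni; apply: iter_bdiff_eq0 ni => {}i.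
by rewrite -[7%N]/(1 + 1 * 6)%N; apply: iter_bdiff_eq0 => -[].
Qed.

Lemma all_nseq_leq1 j k : (0 < k)%N -> all (leq 1) (nseq j k).
Proof. by move=> k0; rewrite all_nseq k0 orbT. Qed.

Lemma psums_base_seq ks : all (leq 1) ks ->
  psums (rev (nseq 8 base_period)) (psums ks base_seq) =1 psums ks (bdiff6 delta0).
Proof.
move=> ks0 n; rewrite rev_nseq -[RHS](@iter_bdiffK 8 base_period) //.
by apply: eq_psums; [apply: all_nseq_leq1 | apply: iter_bdiff_psumsC].
Qed.

Lemma neg_part_sum_tabZ u n :
  neg_part_sum (tabZ u n) = Z_of_int (\sum_(0 <= j < n) Num.max 0 (- u j)).
Proof.
rewrite /tabZ /index_iota subn0; elim: (iota 0 n) => [|i s IH] /=.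
  by rewrite big_nil.
by rewrite big_cons IH; move: (bigop _ _ _) => S; case: leP => u0; lia.
Qed.

Lemma addr_nneg_int (x y : int) : 0 <= x -> 0 <= y -> 0 <= x + y.
Proof. exact: addr_ge0. Qed.

Lemma leb_nneg x : Z.leb Z0 (Z_of_int x) -> 0 <= x.
Proof. by lia. Qed.

Lemma bdiff6_tail_checkP u n : (37 * 80 <= n)%N ->
  (forall i, (n <= i)%N -> 0 <= u i) -> bdiff6_tail_check (tabZ u n) ->
  let c := psum 261 (psums (rev last_parts) (psums (rev next_parts) u)) in
  exists W : int, \sum_(0 <= j < 262) Num.max 0 (- c j) <= W /\
    forall i, (262 <= i)%N -> W <= c i.
Proof.
rewrite /bdiff6_tail_check; set N := (37 * 80)%N => Nn Z2 /andP[] /all_drop_tabZ W2.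
have {}Z2 i : (N <= i)%N -> 0 <= u i.
  by move=> li; case: (ltnP i n) => lin; [apply: leb_nneg; apply: W2; rewrite li|apply: Z2].
rewrite (take_tabZ _ Nn); case E3 : (lsums_check _ _ _) => [l3|//].
have [//|T3 Z3] := lsums_checkP addr_nneg_int leb_nneg _ Z2 E3.
rewrite {E3}T3 => /andP[] /all_drop_tabZ W3.
have {}Z3 i : (560 <= i)%N -> 0 <= psums (rev next_parts) u i.
  by move=> li; case: (ltnP i N) => lin; [apply: leb_nneg; apply: W3; rewrite li|apply: Z3].
rewrite (@take_tabZ _ 560 N isT); case E4 : (lsums_check _ _ _) => [l4|//].
have [|T4 Z4] := lsums_checkP addr_nneg_int leb_nneg _ Z3 E4.
  by apply/allP => k; rewrite mem_filter mem_iota; lia.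
rewrite {E4}T4 (@lsum_tabZ 261 _ _ isT) => W5; set v := psums (rev last_parts) _ in W5 Z4 *.
move: W5; cbv zeta; rewrite (@take_tabZ _ 262 560 isT) neg_part_sum_tabZ.
set W := (\sum_(_ <= j < _) _) => /all_drop_tabZ W5.
exists W; split=> // i li.
case: (ltnP i 560) => ib; first by have := W5 i; lia.
apply: (@psum_window 261 _ 560 (fun x => 0 <= x) (fun x => W <= x)) => //.
- by move=> x y; lia.
- by move=> j jn; have := W5 j; lia.
- by lia.
Qed.

Lemma psums_cons k ks u : psums (k :: ks) u = psum k (psums ks u).
Proof. by []. Qed.

Lemma psums_all_parts :
  psum 261 (psums (rev last_parts) (psums (rev next_parts)
    (psums (rev base_parts) (bdiff6 delta0)))) =1 bdiff6 (pparts 261).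
Proof.
move=> i; rewrite (bdiff6_psumsC _ (all_rev_iota1 261)).
rewrite (psums_perm _ (all_rev_iota1 261) (ls := 261 :: rev last_parts ++ rev next_parts ++ rev base_parts)%N).
  by rewrite psums_cons !psums_cat.
by rewrite perm_sym perm_all_parts.
Qed.

Lemma bdiff6_pparts_base :
  exists W : int,
    \sum_(0 <= j < 262) Num.max 0 (- bdiff6 (pparts 261) j) <= W /\
    forall i, (262 <= i)%N -> W <= bdiff6 (pparts 261) i.
Proof.
have := bdiff6_check_true; rewrite /bdiff6_check base_list_tabZ.
have a0 : all (leq 1) (rev base_parts) by [].
case E1 : (lsums_check _ _ _) => [l1|//].
have [||||T1 Z1] := lsums_checkP (Q := fun x => x = 0) _ _ _ _ E1.
- by move=> x y -> ->.
- by move=> x; lia.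
- by rewrite /= /base_length; lia.
- exact: base_seq_eq0.
rewrite {E1}T1; case E2 : (lsums_check _ _ _) => [l2|//].
have [|i /Z1 -> //|T2 Z2] := lsums_checkP addr_nneg_int leb_nneg _ _ E2.
  by rewrite all_nseq /base_length /base_period; lia.
rewrite {E2}(etrans T2 (eq_tabZ _ (psums_base_seq a0))).
move=> tc; have Bl : (37 * 80 <= base_length)%N.
  by rewrite /base_length /base_period; lia.
have {}Z2 i : (base_length <= i)%N -> 0 <= psums (rev base_parts) (bdiff6 delta0) i.
  by rewrite -(psums_base_seq a0); apply: Z2.
have [W [sW cW]] := bdiff6_tail_checkP Bl Z2 tc.
exists W; split=> [|i /cW]; last by rewrite psums_all_parts.
by rewrite -(eq_bigr _ (fun j _ => congr1 (fun x => Num.max 0 (- x)) (psums_all_parts j))).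
Qed.

(* Each negative coefficient of index below 262 is added to a given later coefficient by
   at most one of the divisions by [1 - x^k], [k > 261], hence a total loss of at most [W]. *)
Lemma bdiff6_pparts_ge0 k i : (261 <= k)%N -> (262 <= i)%N -> 0 <= bdiff6 (pparts k) i.
Proof.
have [W [leW geW]] := bdiff6_pparts_base; set c := bdiff6 (pparts 261) in leW geW.
pose ng j := if (j < 262)%N then Num.max 0 (- c j) else 0.
pose Ng t := \sum_(0 <= j < t) ng j.
have ng_ge0 j : 0 <= ng j by rewrite /ng; case: ifP => // _; lia.
have NgS t : Ng t.+1 = Ng t + ng t by rewrite /Ng big_nat_recr.
have Ng_ge0 t : 0 <= Ng t by apply: sumr_ge0 => j _.
have Ng_le t : Ng t <= W.
  have Ng262 : Ng 262 <= W.
    by apply: le_trans leW; apply: ler_sum_nat => j /andP[_ j262]; rewrite /ng j262.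
  case: (leqP t 262) => t262.
    apply: le_trans Ng262; rewrite /Ng (big_cat_nat (n := t) (p := 262)) //= lerDl.
    by apply: sumr_ge0 => j _.
  rewrite /Ng (big_cat_nat (n := 262)) //=; last by lia.
  rewrite [X in _ + X]big1_seq ?addr0 // => j; rewrite mem_index_iota => /andP[_ /andP[j262 _]].
  by rewrite /ng ltnNge j262.
have step k' i' : bdiff6 (pparts k'.+1) i' = bdiff6 (pparts k') i' +
    (if (k' < i')%N then bdiff6 (pparts k'.+1) (i' - k'.+1)%N else 0).
  rewrite ppartsS bdiff6_psumC // psumE //; congr (_ + _); case: ifP => // _.
  by rewrite bdiff6_psumC.
have low j l : (l < 262)%N -> bdiff6 (pparts (261 + j)) l = c l.
  move=> l262; elim: j => [|j IH]; first by rewrite addn0.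
  by rewrite addnS step IH ifF ?addr0 //; lia.
(* The induction on [k] needs the stronger bound [Ng (i - k)]: passing to the part [k + 1] adds the
   coefficient at [t = i - k - 1], which costs at most [ng t], exactly the difference
   [Ng t.+1 - Ng t]. *)
move=> k261 i262; apply: (le_trans (Ng_ge0 (i - k)%N)).
rewrite -(subnKC k261); elim: (k - 261)%N i i262 => [|j IH] i i262.
  by rewrite addn0; apply: le_trans (Ng_le _) (geW _ i262).
rewrite addnS; elim/ltn_ind: i i262 => i IHi i262; rewrite step.
have := IH i i262; case: ltnP => ji; last first.
  have -> : (i - (261 + j).+1 = 0)%N by lia.
  by move=> IHt; rewrite addr0 /Ng big_geq //; exact: le_trans (Ng_ge0 _) IHt.
have -> : (i - (261 + j))%N = (i - (261 + j).+1)%N.+1 by lia.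
set t := (i - (261 + j).+1)%N; rewrite NgS => IHt.
case: (ltnP t 262) => t262.
  rewrite -addnS (low j.+1 t t262); move: IHt; rewrite /ng t262.
  by move: (Ng t) (bdiff6 _ i) (c t) => x y z; case: (leP 0 (- z)) => ct; lra.
rewrite -[Ng t]addr0; apply: lerD; first by apply: le_trans IHt; rewrite lerDl ng_ge0.
by apply: le_trans (Ng_ge0 _) (IHi t _ t262); rewrite /t; lia.
Qed.

(** * The slope of p / d *)

Definition pdiff (j : nat) : nat -> int := iter j (bdiff 1) (fun n => (p n)%:Z).

Lemma pdiffS j n : pdiff j n.+1 = pdiff j n + pdiff j.+1 n.+1.
Proof. by rewrite [pdiff j.+1 _]/= /bdiff subn1 /= /pdiff; lia. Qed.

Lemma pdiff_pparts j m n : (n <= m)%N -> pdiff j n = iter j (bdiff 1) (pparts m) n.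
Proof.
elim: j n => [|j IH] n nm /=; first by rewrite pparts_widen.
by rewrite /bdiff IH // IH //; lia.
Qed.

Lemma pdiff6_ge0 n : (262 <= n)%N -> 0 <= pdiff 6 n.
Proof.
by move=> n262; rewrite (@pdiff_pparts _ n) //; apply: bdiff6_pparts_ge0 => //; lia.
Qed.

(* If [a' = b] and [b' = c], this says that [(a / b)' <= 1 / mu], as for [a = t^mu]. *)
Definition turan (mu : int) (j n : nat) : Prop :=
  (mu - 1) * pdiff j.+1 n * pdiff j.+1 n.+1 <= mu * pdiff j n * pdiff j.+2 n.+1.

(** After multiplication by [pdiff j.+2 n.+1], the right side minus the left side of the new
    inequality is a combination, with nonnegative coefficients, of the same differences for the two
    given ones. *)
Lemma turan_step mu j n : 0 < pdiff j.+2 n.+1 -> 0 <= pdiff j.+1 n.+1 ->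
  0 <= pdiff j.+2 n.+2 ->
  turan mu j n -> turan (mu - 1) j.+1 n.+1 -> turan mu j n.+1.
Proof.
rewrite /turan [pdiff j n.+1]pdiffS [pdiff j.+1 n.+2]pdiffS.
have := pdiffS j.+1 n; have := pdiffS j.+2 n.+1.
set A := pdiff j n; set B := pdiff j.+1 n; set B' := pdiff j.+1 n.+1.
set C' := pdiff j.+2 n.+1; set C2 := pdiff j.+2 n.+2; set D2 := pdiff j.+3 n.+2.
move=> C2E B'E C0 B0 C20 T T'; rewrite -subr_ge0 -(pmulr_rge0 _ C0).
have -> : C' * (mu * (A + B') * C2 - (mu - 1) * B' * (B' + C2)) =
    C2 * (mu * A * C' - (mu - 1) * B * B') +
    B' * ((mu - 1) * B' * D2 - (mu - 1 - 1) * C' * C2).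
  by rewrite C2E B'E; ring.
by rewrite addr_ge0 // mulr_ge0 // subr_ge0.
Qed.

Definition ptable (n : nat) : seq Z :=
  foldl (fun l k => lsum k l) (Z.one :: nseq n Z0) (iota 1 n).

Lemma ptable_tabZ n : ptable n = tabZ (fun i => (p i)%:Z) n.+1.
Proof.
have gen m : foldl (fun l k => lsum k l) (Z.one :: nseq n Z0) (iota 1 m) =
    tabZ (pparts m) n.+1.
  elim: m => [|m IH]; first by rewrite tabZ_delta0.
  have -> : iota 1 m.+1 = iota 1 m ++ [:: m.+1] by rewrite -[in LHS](addn1 m) iotaD.
  by rewrite foldl_cat IH /= lsum_tabZ // ppartsS.
rewrite /ptable gen; apply/eq_in_map => i; rewrite mem_iota => /andP[_ lin].
by rewrite pparts_widen //; lia.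
Qed.

Fixpoint near_log_convex_check (n : Z) (l : seq Z) : bool :=
  if l is a :: (b :: c :: _) as l' then
    Z.ltb (Z.mul n (Z.mul b b)) (Z.mul (Z.succ n) (Z.mul a c)) &&
    near_log_convex_check (Z.succ n) l'
  else true.

Definition turan_check (mu : Z) (j n : nat) (l : seq Z) : bool :=
  let a k i := nth Z0 (iter k (ldiff 1) l) i in
  [&& Z.ltb Z0 (a j n) &
   Z.leb (Z.mul (Z.mul (Z.pred mu) (a j.+1 n)) (a j.+1 n.+1))
         (Z.mul (Z.mul mu (a j n)) (a j.+2 n.+1))].

(** The inequality at [n = 1020] reads [p 1021]; the Turan-type conditions at 300 read indices up to
    301, hence 302 entries. *)
Definition ptable_check : bool :=
  let t := ptable 1021 in
  let t' := take 302 t in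
  [&& near_log_convex_check Z.one t,
   turan_check 5 0 300 t', turan_check 4 1 300 t', turan_check 3 2 300 t',
   turan_check 2 3 300 t', turan_check 1 4 300 t' & turan_check 0 5 300 t'].

Lemma ptable_check_true : ptable_check.
Proof. by vm_cast_no_check (erefl true). Qed.

Lemma turan_checkP mu j n N : (n.+1 < N)%N ->
  turan_check (Z_of_int mu) j n (tabZ (fun i => (p i)%:Z) N) ->
  0 < pdiff j n /\ turan mu j n.
Proof.
move=> nN; rewrite /turan_check !iter_ldiff_tabZ !nth_tabZ; try lia.
rewrite -!/(pdiff _) /turan => /andP[]; split; first by lia.
by nia.
Qed.

Lemma near_log_convex_checkP z l :
  near_log_convex_check z l -> forall i, (i.+2 < size l)%N ->
  Z.lt (Z.mul (Z.add z (Z.of_nat i)) (Z.mul (nth Z0 l i.+1) (nth Z0 l i.+1)))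
       (Z.mul (Z.succ (Z.add z (Z.of_nat i))) (Z.mul (nth Z0 l i) (nth Z0 l i.+2))).
Proof.
elim: l z => [//|a l IH] z; case: l IH => [//|b [//|c l]] IH /andP[abc chk] [_|i li].
  by rewrite /=; lia.
have := IH _ chk i li.
have -> : Z.add (Z.succ z) (Z.of_nat i) = Z.add z (Z.of_nat i.+1) by lia.
exact.
Qed.

Lemma p_near_log_convex_small n : (0 < n < 1021)%N ->
  (n * (p n * p n) < n.+1 * (p n.-1 * p n.+1))%N.
Proof.
case: n => [//|n] /= n1021.
have := ptable_check_true; rewrite /ptable_check ptable_tabZ => /andP[+ _].
move=> /near_log_convex_checkP - /(_ n); rewrite size_tabZ => H.
have {}H := H n1021; move: H; rewrite !nth_tabZ; try lia.
by rewrite -[Z.one]/(Zpos xH); move: (p n) (p n.+1) (p n.+2) => a b c; lia.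
Qed.

Definition turan_chain (n : nat) : Prop :=
  [/\ forall j, (j < 6)%N -> 0 < pdiff j n,
      turan 5 0 n, turan 4 1 n, turan 3 2 n & turan 2 3 n].

Lemma turan_chain_300 : turan_chain 300.
Proof.
have := ptable_check_true; rewrite /ptable_check ptable_tabZ (@take_tabZ _ 302 1022 isT).
move=> /and5P[_ c0 c1 c2 /and3P[c3 c4 c5]].
have [d0 t0] := @turan_checkP 5 0 300 302 isT c0.
have [d1 t1] := @turan_checkP 4 1 300 302 isT c1.
have [d2 t2] := @turan_checkP 3 2 300 302 isT c2.
have [d3 t3] := @turan_checkP 2 3 300 302 isT c3.
have [d4 _] := @turan_checkP 1 4 300 302 isT c4.
have [d5 _] := @turan_checkP 0 5 300 302 isT c5.
clear c0 c1 c2 c3 c4 c5; split; [|exact: t0|exact: t1|exact: t2|exact: t3].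
move=> j j6; case: j j6 => [_|j]; first exact: d0.
case: j => [_|j]; first exact: d1.
case: j => [_|j]; first exact: d2.
case: j => [_|j]; first exact: d3.
case: j => [_|j]; first exact: d4.
by case: j => [_|j]; [exact: d5 | clear].
Qed.

(** The sixth difference enters twice: it keeps all lower differences positive, and it gives
    [turan 1 4], whose left side is 0. From there [turan_step] climbs to [turan 5 0]. *)
Lemma turan_chain_ge n : (300 <= n)%N -> turan_chain n.
Proof.
move=> n300; rewrite -(subnKC n300); elim: (n - 300)%N => [|i].
  by rewrite addn0; apply: turan_chain_300.
rewrite addnS; move: (300 + i)%N (leq_addr i 300) => {n i n300} n n300.
move=> [pos t0 t1 t2 t3].
have pos5 m : (n <= m)%N -> forall j, (j < 6)%N -> 0 < pdiff j m.
  move=> nm; rewrite -(subnKC nm); elim: (m - n)%N => [|i IH] j j6; first by rewrite addn0 pos.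
  have j5 : (j <= 5)%N by lia.
  rewrite addnS -(subKn j5); elim: (5 - j)%N (leq_subr j 5) => [|l IHl] l5.
    by rewrite subn0 pdiffS ltr_wpDr ?IH // pdiff6_ge0 //; lia.
  rewrite pdiffS; have -> : (5 - l.+1).+1 = (5 - l)%N by lia.
  by apply: addr_gt0; [apply: IH; lia | apply: IHl; lia].
have pos' j : (j < 6)%N -> 0 < pdiff j n.+1 by apply: pos5.
have pos'' j : (j < 6)%N -> 0 < pdiff j n.+2 by apply: pos5; lia.
have t4' : turan 1 4 n.+1.
  rewrite /turan subrr !mul0r mul1r mulr_ge0 ?pdiff6_ge0 //; last by lia.
  by rewrite ltW ?pos'.
have t3' : turan 2 3 n.+1 by apply: turan_step t3 t4'; rewrite ?ltW ?pos' ?pos''.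
have t2' : turan 3 2 n.+1 by apply: turan_step t2 t3'; rewrite ?ltW ?pos' ?pos''.
have t1' : turan 4 1 n.+1 by apply: turan_step t1 t2'; rewrite ?ltW ?pos' ?pos''.
have t0' : turan 5 0 n.+1 by apply: turan_step t0 t1'; rewrite ?ltW ?pos' ?pos''.
by split.
Qed.

(** * Growth of [p] from the slope bound *)

Definition pq (n : nat) : rat := (p n)%:R.

Definition dq (n : nat) : rat := (pdiff 1 n)%:~R.

Lemma pqS n : pq n.+1 = pq n + dq n.+1.
Proof. by rewrite /pq /dq -[LHS]/((pdiff 0 n.+1)%:~R) pdiffS intrD. Qed.

Lemma pq_gt0 n : 0 < pq n.
Proof. by rewrite ltr0n p_gt0. Qed.

Lemma pq_le i j : (i <= j)%N -> pq i <= pq j.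
Proof. by move=> ij; rewrite ler_nat leq_p. Qed.

Lemma dq_gt0 n : (300 <= n)%N -> 0 < dq n.
Proof. by move=> /turan_chain_ge[pos _ _ _ _]; rewrite ltr0z pos. Qed.

Lemma turan_pq n : (300 <= n)%N -> 4 * dq n * dq n.+1 <= 5 * pq n * (dq n.+1 - dq n).
Proof.
move=> /turan_chain_ge[_ t _ _ _]; move: t; rewrite /turan.
have -> : pdiff 2 n.+1 = pdiff 1 n.+1 - pdiff 1 n by rewrite (pdiffS 1 n); ring.
rewrite -(ler_int rat) !intrM intrB /dq /pq -[(pdiff 0 n)%:~R]/((p n)%:R).
exact.
Qed.

(** Divided by [5 * dq n * dq n.+1], [turan_pq] says that [h(n+1) - h(n) <= 1/5]. *)
Lemma turan_ratio n X : (300 <= n)%N -> 5 * pq n <= X * dq n ->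
  forall j, 5 * pq (n + j) <= (X + j%:R) * dq (n + j).
Proof.
move=> n300 H; elim=> [|j IH]; first by rewrite addn0 addr0.
have n300' : (300 <= n + j)%N by lia.
have := turan_pq n300'; have := dq_gt0 n300'; have := pqS (n + j).
rewrite addnS -(natr1 j) addrA; move: IH; set P := pq _; set P' := pq _; set d := dq _; set d' := dq _.
set Z := X + j%:R => IH -> d0 T; have d'0 : 0 < d' by apply: dq_gt0; lia.
suff : 5 * P <= (Z - 4) * d' by lra.
rewrite -(ler_pM2l d0); have := ler_wpM2r (ltW d'0) IH; lra.
Qed.

(** With [Z = X + j + 1], the bound on [h] gives [p(n+j) <= p(n+j+1) (1 - 5/Z)], and
    [1 - 5/Z <= (1 - 1/Z)^5] by Bernoulli. *)
Lemma pq_ratio_step n X j : (300 <= n)%N -> 0 <= X -> 5 * pq n <= X * dq n ->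
  pq (n + j) * (X + j.+1%:R) ^+ 5 <= pq (n + j.+1) * (X + j%:R) ^+ 5.
Proof.
move=> n300 X0 H; have := turan_ratio n300 H j.+1; have := pqS (n + j).
rewrite addnS; set P := pq (n + j); set P' := pq (n + j).+1; set d := dq _.
have -> : X + j%:R = (X + j.+1%:R) - 1 by rewrite -(natr1 j); lra.
have : 1 <= X + j.+1%:R by rewrite -(natr1 j); have := ler0n rat j; lra.
set Z := X + j.+1%:R => Z1 PE dP.
have P'0 : 0 < P' by apply: pq_gt0.
have -> : P = P' - d by rewrite PE; ring.
have Z4 : 0 <= Z ^+ 4 by rewrite exprn_ge0 //; lra.
apply: (@le_trans _ _ (P' * (Z ^+ 5 - 5 * Z ^+ 4))).
  have := ler_wpM2r Z4 dP; rewrite !mulrBr mulrBl.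
  have -> : Z * d * Z ^+ 4 = d * Z ^+ 5 by ring.
  have -> : P' * (5 * Z ^+ 4) = 5 * P' * Z ^+ 4 by ring.
  by lra.
rewrite ler_pM2l // -subr_ge0.
have : 0 <= Z ^+ 2 * (Z - 1) by rewrite mulr_ge0 ?exprn_ge0 //; lra.
by lra.
Qed.

Lemma pq_ratio n X k j : (300 <= n)%N -> 0 < X -> 5 * pq n <= X * dq n -> (j <= k)%N ->
  pq (n + k - j) * (X + k%:R) ^+ 5 <= pq (n + k) * (X + k%:R - j%:R) ^+ 5.
Proof.
move=> n300 X0 H; elim: j => [|j IH] jk; first by rewrite subn0 subr0.
have kE : k = ((k - j.+1) + j.+1)%N by lia.
have := pq_ratio_step (k - j.+1) n300 (ltW X0) H.
have -> : (n + (k - j.+1))%N = (n + k - j.+1)%N by lia.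
have -> : (n + (k - j.+1).+1)%N = (n + k - j)%N by lia.
have -> : X + (k - j.+1).+1%:R = X + k%:R - j%:R.
  by rewrite subnSK // natrB ?addrA //; lia.
have -> : X + (k - j.+1)%:R = X + k%:R - j.+1%:R by rewrite natrB ?addrA.
have {IH} := IH (ltnW jk).
set P := pq (n + k - j); set P' := pq (n + k - j.+1); set PN := pq (n + k).
set Y := X + k%:R; set u := Y - j%:R; set v := Y - j.+1%:R => IH step.
have kj : j.+1%:R <= k%:R :> rat by rewrite ler_nat.
have v0 : 0 < v by rewrite /v /Y; lra.
have u0 : 0 < u by rewrite /u; move: v0; rewrite /v -(natr1 j); lra.
have Y0 : 0 < Y by rewrite /Y; have := ler0n rat k; lra.
rewrite -(ler_pM2r (exprn_gt0 5 u0)).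
have := ler_wpM2r (exprn_ge0 5 (ltW v0)) IH.
have := ler_wpM2r (exprn_ge0 5 (ltW Y0)) step.
by lra.
Qed.

(** * Large n *)

Lemma sum_arith_block (a B : nat) :
  \sum_(a * B + 1 <= j < a * B.+1 + 1) (j%:R + (a%:R - 1) / 2) = a%:R ^+ 2 * B.+1%:R :> rat.
Proof.
have gen s : \sum_(a * B + 1 <= j < a * B + s + 1) j%:R =
    s%:R * (a%:R * B%:R) + s%:R * (s%:R + 1) / 2 :> rat.
  elim: s => [|s IH]; first by rewrite addn0 big_geq // !mul0r addr0.
  have -> : (a * B + s.+1 + 1 = (a * B + s + 1).+1)%N by lia.
  rewrite big_nat_recr /=; last by lia.
  by rewrite IH !natrD natrM -(natr1 s); field.
have -> : (a * B.+1 + 1 = a * B + a + 1)%N by lia.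
rewrite big_split /= gen sumr_const_nat -mulr_natl.
have -> : (a * B + a + 1 - (a * B + 1) = a)%N by lia.
by rewrite -(natr1 B); field.
Qed.

(** The term [b] is spread over the block [a (b-1) < j <= a b], where [p(N - j) >= p(N - a b)]. The
    shift [(a-1)/2] makes the weights of the block add up to exactly [a^2 b]. *)
Lemma dilated_sum_le (N a B : nat) : (0 < a)%N -> (a * B <= N)%N ->
  a%:R ^+ 2 * \sum_(1 <= b < B.+1) b%:R * pq (N - a * b) <=
  \sum_(1 <= j < (a * B).+1) (j%:R + (a%:R - 1) / 2) * pq (N - j).
Proof.
move=> a0; elim: B => [|B IH] aBN.
  by rewrite muln0 !big_geq ?mulr0.
rewrite big_nat_recr //= mulrDr -[(a * B.+1).+1]addn1.
rewrite [leRHS](big_cat_nat (n := (a * B + 1)%N)) /=; try lia.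
apply: lerD; first by rewrite addn1; apply: IH; lia.
rewrite mulrA -(sum_arith_block a B) mulr_suml; apply: ler_sum_nat => j /andP[j1 j2].
apply: ler_wpM2l; last by apply: pq_le; lia.
have : 1 <= a%:R :> rat by rewrite ler1n.
by have := ler0n rat j; lra.
Qed.

Lemma dilated_sum_cond_le (N a : nat) : (0 < a)%N ->
  a%:R ^+ 2 * \sum_(1 <= b < N.+1 | (a * b <= N)%N) b%:R * pq (N - a * b) <=
  \sum_(1 <= j < N.+1) j%:R * pq (N - j) +
  (a%:R - 1) / 2 * \sum_(1 <= j < N.+1) pq (N - j).
Proof.
move=> a0; set B := (N %/ a)%N.
have aB : (a * B <= N)%N by rewrite mulnC leq_trunc_div.
have BN : (B <= N)%N by rewrite leq_div.
have -> : \sum_(1 <= b < N.+1 | (a * b <= N)%N) b%:R * pq (N - a * b) =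
    \sum_(1 <= b < B.+1) b%:R * pq (N - a * b).
  rewrite (big_cat_nat (n := B.+1)) //= [X in _ + X]big1_seq ?addr0.
    rewrite big_mkcond; apply: eq_big_nat => b /andP[_ bB].
    by rewrite ifT //; apply: leq_trans aB; rewrite leq_mul2l -ltnS bB orbT.
  move=> b; rewrite mem_index_iota => /andP[abN /andP[Bb _]].
  by move: Bb; rewrite ltn_divLR // mulnC ltnNge abN.
apply: le_trans (dilated_sum_le a0 aB) _.
rewrite mulr_sumr -big_split /= [leRHS](big_cat_nat (n := (a * B).+1)) //=.
under [X in _ <= X + _]eq_bigr => j _ do rewrite -mulrDl.
rewrite lerDl; apply: sumr_ge0 => j _; rewrite -mulrDl mulr_ge0 ?(ltW (pq_gt0 _)) //.
have : 1 <= a%:R :> rat by rewrite ler1n.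
by have := ler0n rat j; lra.
Qed.

Lemma pq_weighted_sum n : n%:R * pq n =
  \sum_(1 <= a < n.+1) \sum_(1 <= b < n.+1 | (a * b <= n)%N) b%:R * pq (n - a * b).
Proof.
have := congr1 (fun z : int => z%:~R : rat) (p_weighted_sum n).
rewrite /= intrM rmorph_sum /= => ->; apply: eq_bigr => a _.
by rewrite rmorph_sum; apply: eq_bigr => b _; rewrite rmorphM.
Qed.

Lemma pq_weighted_sum_le n :
  n%:R * pq n <=
  (\sum_(1 <= a < n.+1) a%:R ^- 2) * (\sum_(1 <= j < n.+1) j%:R * pq (n - j)) +
  (\sum_(1 <= a < n.+1) (a%:R - 1) / a%:R ^+ 2) / 2 * (\sum_(1 <= j < n.+1) pq (n - j)).
Proof.
rewrite pq_weighted_sum !mulr_suml -big_split /=; apply: ler_sum_nat => a /andP[a1 _].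
have a0 : 0 < a%:R :> rat by rewrite ltr0n.
have a20 : 0 < a%:R ^+ 2 :> rat by rewrite exprn_gt0.
rewrite -(ler_pM2l a20); apply: le_trans (dilated_sum_cond_le n a1) _.
rewrite le_eqVlt; apply/orP; left; apply/eqP; field.
by rewrite gt_eqF.
Qed.

(** * Explicit estimates of the sums *)

(** Telescoping of [1/a^2 <= 1/(a - 1/2) - 1/(a + 1/2)]. The constant 33/20, slightly above
    [pi^2/6], makes the case [n = 2] an equality. *)
Lemma sum_inv_sqr_le n : (2 <= n)%N ->
  \sum_(1 <= a < n.+1) a%:R ^- 2 <= 33 / 20 - (n%:R + 1 / 2)^-1 :> rat.
Proof.
move=> n2; rewrite -(subnKC n2); elim: (n - 2)%N => [|j IH].
  rewrite addn0; have -> : \sum_(1 <= a < 3) a%:R ^- 2 = 1%:R ^- 2 + (2%:R ^- 2 + 0) :> rat.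
    by rewrite unlock.
  by rewrite le_eqVlt; apply/orP; left; apply/eqP; field.
rewrite addnS big_nat_recr; last by lia.
rewrite [_ + _]/=; apply: le_trans (lerD IH (lexx _)) _.
rewrite -(natr1 (2 + j)); set x : rat := (2 + j)%:R.
have x2 : 2 <= x by rewrite ler_nat.
rewrite -subr_ge0.
have -> : 33 / 20 - (x + 1 + 1 / 2)^-1 - (33 / 20 - (x + 1 / 2)^-1 + (x + 1) ^- 2) =
   1 / 4 / ((x + 1 + 1 / 2) * (x + 1 / 2) * (x + 1) ^+ 2).
  by field; rewrite !gt_eqF //; lra.
by rewrite divr_ge0 // !mulr_ge0 ?exprn_ge0 //; lra.
Qed.

(** Each term is at most [1/(a+1)], hence at most [1/(m+2)] on the block. *)
Lemma sum_pred_div_sqr_block m n : (m <= n)%N ->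
  \sum_(1 <= a < n.+1) (a%:R - 1) / a%:R ^+ 2 <=
  \sum_(1 <= a < m.+1) (a%:R - 1) / a%:R ^+ 2 + (n%:R - m%:R) / (m%:R + 2) :> rat.
Proof.
move=> mn; rewrite (big_cat_nat (n := m.+1)) //= lerD2l.
apply: (@le_trans _ _ (\sum_(m.+1 <= a < n.+1) (m%:R + 2)^-1)); last first.
  by rewrite sumr_const_nat subSS -natrB // mulr_natl.
apply: ler_sum_nat => a /andP[ma _].
have ma' : m%:R + 1 <= a%:R :> rat by rewrite natr1 ler_nat.
have m0 := ler0n rat m.
rewrite ler_pdivrMr ?exprn_gt0; try lra.
rewrite mulrC ler_pdivlMr; last by lra.
set x : rat := a%:R in ma' *; set y : rat := m%:R in ma' m0 *.
nra.
Qed.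

Lemma sum_lin_pow5_le (Y : rat) k : k%:R <= Y ->
  \sum_(1 <= j < k.+1) j%:R * (Y - j%:R) ^+ 5 <=
  (Y ^+ 7 - (k%:R + 1) * (Y - k%:R) ^+ 7 + k%:R * (Y - k%:R - 1) ^+ 7) / 42.
Proof.
elim: k => [|k IH] kY; first by rewrite big_geq // !mul0r !add0r mul1r !subr0 subrr mul0r.
rewrite big_nat_recr; last by lia.
have kY' : k%:R <= Y by move: kY; rewrite -(natr1 k); lra.
rewrite [_ + _]/=; apply: le_trans (lerD (IH kY') (lexx _)) _.
move: kY; rewrite -(natr1 k); set x : rat := k%:R => kY.
have [z zE] : exists z, z = Y - (x + 1) by eexists.
have -> : Y - x = z + 1 by rewrite zE; ring.
rewrite -zE; have z0 : 0 <= z by rewrite zE; lra.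
have x0 : 0 <= x by rewrite ler0n.
have z3 : 0 <= (x + 1) * z ^+ 3 by rewrite mulr_ge0 ?exprn_ge0 //; lra.
have z1 : 0 <= (x + 1) * z by rewrite mulr_ge0 //; lra.
by lra.
Qed.

Lemma sum_pow5_le (Y : rat) k : k%:R <= Y ->
  \sum_(1 <= j < k.+1) (Y - j%:R) ^+ 5 <= (Y ^+ 6 - (Y - k%:R) ^+ 6) / 6.
Proof.
elim: k => [|k IH] kY; first by rewrite big_geq // subr0 subrr mul0r.
rewrite big_nat_recr; last by lia.
have kY' : k%:R <= Y by move: kY; rewrite -(natr1 k); lra.
rewrite [_ + _]/=; apply: le_trans (lerD (IH kY') (lexx _)) _.
move: kY; rewrite -(natr1 k); set x : rat := k%:R => kY.
have [z zE] : exists z, z = Y - (x + 1) by eexists.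
have -> : Y - x = z + 1 by rewrite zE; ring.
rewrite -zE; have z0 : 0 <= z by rewrite zE; lra.
have z4 : 0 <= z ^+ 4 by rewrite exprn_ge0.
have z3 : 0 <= z ^+ 3 by rewrite exprn_ge0.
have z2 : 0 <= z ^+ 2 by rewrite exprn_ge0.
by lra.
Qed.

(** The left side is the part [a = 1] of the identity [pq_weighted_sum]. *)
Lemma sum_lin_pq_le n : \sum_(1 <= j < n.+1) j%:R * pq (n - j) <= n%:R * pq n.
Proof.
case: n => [|n]; first by rewrite big_geq // mul0r.
have pos a : 0 <= \sum_(1 <= b < n.+2 | (a * b <= n.+1)%N) b%:R * pq (n.+1 - a * b).
  by apply: sumr_ge0 => b _; rewrite mulr_ge0 ?ler0n // ltW ?pq_gt0.
rewrite pq_weighted_sum [leRHS]big_ltn // -[leLHS]addr0; apply: lerD.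
  rewrite big_mkcond [leRHS]big_mkcond /= le_eqVlt; apply/orP; left; apply/eqP.
  by apply: eq_big_nat => b /andP[_ bn]; rewrite mul1n ifT.
by apply: sumr_ge0 => a _; apply: pos.
Qed.

(** Write [k = j + (k - j)]: the weights [j] are covered by [sum_lin_pq_le]; the weights [k - j] are
    nonpositive from [j = k] on, and before that [p(n - j) <= p(n)]. *)
Lemma sum_pq_le n k : (k <= n)%N ->
  k%:R * \sum_(1 <= j < n.+1) pq (n - j) <= (n%:R + k%:R ^+ 2 / 2) * pq n.
Proof.
move=> kn; rewrite mulrDl; apply: le_trans (lerD (sum_lin_pq_le n) (lexx _)).
rewrite mulr_sumr -lerBlDl -sumrB (big_cat_nat (n := k.+1)) //=.
rewrite -[leRHS]addr0; apply: lerD; last first.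
  rewrite -oppr_ge0 -sumrN big_nat; apply: sumr_ge0 => j /andP[kj _].
  rewrite -mulrBl oppr_ge0 mulr_le0_ge0 ?(ltW (pq_gt0 _)) //.
  by rewrite subr_le0 ler_nat ltnW.
apply: (@le_trans _ _ (\sum_(1 <= j < k.+1) (k%:R - j%:R) * pq n)).
  apply: ler_sum_nat => j /andP[_ jk]; rewrite -mulrBl ler_wpM2l ?pq_le ?leq_subr //.
  by rewrite subr_ge0 ler_nat.
rewrite -mulr_suml ler_wpM2r ?(ltW (pq_gt0 _)) //.
have gen m : \sum_(1 <= j < m.+1) (k%:R - j%:R) = m%:R * k%:R - m%:R * (m%:R + 1) / 2 :> rat.
  elim: m => [|m IH]; first by rewrite big_geq // !mul0r subr0.
  rewrite big_nat_recr; last by lia.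
  by rewrite /= IH -(natr1 m); field.
rewrite gen; have := ler0n rat k; lra.
Qed.

(** Dyadic blocks from 4 to 128 give 4927/1000; one block to [8 k] and one to [n] follow. The true
    growth is logarithmic, but a bound linear in [k] is enough later. *)
Lemma sum_pred_div_sqr_le n k : (16 <= k)%N -> (8 * k <= n)%N ->
  \sum_(1 <= a < n.+1) (a%:R - 1) / a%:R ^+ 2 <=
  4927 / 1000 + (8 * k%:R - 128) / 130 + (n%:R / k%:R - 8) / 8 :> rat.
Proof.
move=> k16 kn; have k128 : (128 <= 8 * k)%N by lia.
have k0 : 16 <= k%:R :> rat by rewrite ler_nat.
have kn0 : k%:R != 0 :> rat by rewrite pnatr_eq0; lia.
have nk : 8 * k%:R <= n%:R :> rat by rewrite -natrM ler_nat.
have [q qE] : exists q : rat, q = n%:R / k%:R by eexists.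
have nE : n%:R = q * k%:R by rewrite qE divfK.
have q8 : 0 <= q - 8 by rewrite qE subr_ge0 ler_pdivlMr ?nk //; clear -k0; lra.
suff : \sum_(1 <= a < n.+1) (a%:R - 1) / a%:R ^+ 2 <=
    4927 / 1000 + (8 * k%:R - 128) / 130 + (q - 8) / 8 by rewrite qE.
have [L LE] : exists L : nat -> rat,
  forall n, L n = \sum_(1 <= a < n.+1) (a%:R - 1) / a%:R ^+ 2 by eexists.
have L4 : L 4 = 95 / 144.
  have -> : L 4 = (1 - 1) / 1 ^+ 2 + ((2%:R - 1) / 2%:R ^+ 2 + ((3%:R - 1) / 3%:R ^+ 2 +
      ((4%:R - 1) / 4%:R ^+ 2 + 0))) by rewrite LE unlock.
  by field.
have block l m c : (l <= m)%N -> m%:R - l%:R <= c * (l%:R + 2) -> L m <= L l + c.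
  move=> lm lmc; rewrite !LE; apply: le_trans (sum_pred_div_sqr_block lm) _.
  have l2 : 0 < l%:R + 2 :> rat by apply: ltr_wpDl; rewrite ?ler0n.
  by rewrite lerD2l (ler_pdivrMr _ _ l2); exact: lmc.
rewrite -LE {LE}.
have b8 : L 8 <= L 4 + 4 / 6 by apply: block; [by [] | lra].
have b16 : L 16 <= L 8 + 8 / 10 by apply: block; [by [] | lra].
have b32 : L 32 <= L 16 + 16 / 18 by apply: block; [by [] | lra].
have b64 : L 64 <= L 32 + 32 / 34 by apply: block; [by [] | lra].
have b128 : L 128 <= L 64 + 64 / 66 by apply: block; [by [] | lra].
have bk : L (8 * k)%N <= L 128 + (8 * k%:R - 128) / 130.
  by apply: block; [exact: k128 | rewrite (natrM _ 8 k); clear; lra].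
have bn : L n <= L (8 * k)%N + (q - 8) / 8.
  by apply: block; [exact: kn | rewrite (natrM _ 8 k) nE; clear -q8; lra].
clear -b8 b16 b32 b64 b128 bk bn L4; lra.
Qed.

(** * Contradiction from a failure at [n] *)

(** Writing [P], [d] for [pq n], [dq n], [turan_pq] gives [dq n.+1 >= 5 P d / (5 P - 4 d)].
    Inserting this in the failed inequality leaves a bound on [h = P / d] alone:
    [5 h^2 - 4 h <= n + 1]. *)
Lemma near_log_convex_fail_bound n : (301 <= n)%N ->
  n.+1%:R * (pq n.-1 * pq n.+1) <= n%:R * pq n ^+ 2 ->
  5 * pq n ^+ 2 - 4 * pq n * dq n <= n.+1%:R * dq n ^+ 2.
Proof.
move=> n301 fail; have n0 : n = n.-1.+1 by lia.
have PE : pq n = pq n.-1 + dq n by rewrite [in LHS]n0 pqS -n0.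
have P'E := pqS n; have T : 4 * dq n * dq n.+1 <= 5 * pq n * (dq n.+1 - dq n).
  by apply: turan_pq; lia.
have d0 : 0 < dq n by apply: dq_gt0; lia.
have m0 := pq_gt0 n.-1; move: fail; rewrite P'E -(natr1 n).
set P := pq n in PE P'E T *; set d := dq n in d0 PE T *; set d' := dq n.+1 in P'E T *.
have -> : pq n.-1 = P - d by rewrite PE; ring.
move: PE (ler0n rat n) => {P'E}; move: (pq n.-1) m0 (n%:R) => M M0 N PE N0 fail.
have P0 : 0 < P by rewrite PE; lra.
have q0 : 0 < 5 * P - 4 * d by rewrite PE; lra.
have h1 : 0 <= (N + 1) * (P - d) * (d' * (5 * P - 4 * d) - 5 * P * d).
  rewrite mulr_ge0 ?mulr_ge0 //; first by lra.
    by rewrite PE; lra.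
  by lra.
have h2 := ler_wpM2r (ltW q0) fail.
rewrite -subr_ge0 -(pmulr_rge0 _ P0); lra.
Qed.

(** If [5 h > X], then [5 h (5 h - 4) > X (X - 4) >= 5 (n + 1)], against the preceding bound. *)
Lemma turan_start n (X : rat) : (301 <= n)%N ->
  n.+1%:R * (pq n.-1 * pq n.+1) <= n%:R * pq n ^+ 2 ->
  4 < X -> 5 * n.+1%:R <= X * (X - 4) -> 5 * pq n <= X * dq n.
Proof.
move=> n301 /(near_log_convex_fail_bound n301) H X4 XE.
have d0 : 0 < dq n by apply: dq_gt0; lia.
have P0 := pq_gt0 n; rewrite leNgt; apply/negP => lt.
move: H XE; move: (n.+1%:R) (pq n) (dq n) d0 P0 lt => N P d d0 P0 lt H XE.
have h1 : (X - 4) * d < 5 * P - 4 * d by lra.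
have h2 : 0 < (X - 4) * d by rewrite mulr_gt0 //; lra.
have h3 : (X * d) * ((X - 4) * d) < (5 * P) * (5 * P - 4 * d).
  apply: ltr_pM => //; last by apply: ltW.
  by rewrite mulr_ge0 //; lra.
have h4 := ler_wpM2r (ltW (mulr_gt0 d0 d0)) XE.
by lra.
Qed.

(** The second condition is [5 (n + 1) <= X (X - 4)] for [X = 3 k / 2], and the least such [k] fails
    it at [k - 1]. The threshold 1021 is the first [n] for which [k = 49] is too small. *)
Lemma scale_exists n : (1021 <= n)%N -> exists k, [/\ (50 <= k)%N,
  (20 * n.+1 + 24 * k <= 9 * (k * k))%N &
  (9 * (k.-1 * k.-1) < 20 * n.+1 + 24 * k.-1)%N].
Proof.
move=> n1021; have ex : exists k, (20 * n.+1 + 24 * k <= 9 * (k * k))%N.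
  by exists (20 * n.+1)%N; nia.
case: (ex_minnP ex) => k kP kmin; have k50 : (50 <= k)%N by rewrite leqNgt; apply/negP; nia.
exists k; split=> //; rewrite ltnNge; apply/negP => /kmin; lia.
Qed.

Lemma ler_of_pM2r (c x y : rat) : 0 < c -> x * c <= y * c -> x <= y.
Proof. by move=> c0; rewrite ler_pM2r. Qed.

(** With [X = 3 k / 2] one gets [X + k = 5 k / 2], so [X / (X + k)] is the fixed ratio 3/5. *)
Lemma pq_scaled_ratio n k j : (300 <= n)%N -> (0 < k)%N ->
  5 * pq n <= (3 / 2 * k%:R) * dq n -> (j <= k)%N ->
  pq (n + k - j) * (5 / 2 * k%:R) ^+ 5 <= pq (n + k) * (5 / 2 * k%:R - j%:R) ^+ 5.
Proof.
move=> n300 k0 start jk; have X0 : 0 < 3 / 2 * k%:R :> rat.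
  by have : 0 < k%:R :> rat; [rewrite ltr0n | lra].
have -> : 5 / 2 * k%:R = 3 / 2 * k%:R + k%:R :> rat by field.
exact: pq_ratio.
Qed.

Lemma scaled_pow5_gt0 k : (0 < k)%N -> 0 < (5 / 2 * k%:R) ^+ 5 :> rat.
Proof.
by move=> k0; apply: exprn_gt0; have : 0 < k%:R :> rat; [rewrite ltr0n | lra].
Qed.

Lemma pq_start_le n k : (300 <= n)%N -> (0 < k)%N ->
  5 * pq n <= (3 / 2 * k%:R) * dq n -> pq n <= (3 / 5) ^+ 5 * pq (n + k).
Proof.
move=> n300 k0 start; have := pq_scaled_ratio n300 k0 start (leqnn k).
rewrite addnK => H; rewrite -(ler_pM2r (scaled_pow5_gt0 k0)); apply: le_trans H _.
by rewrite le_eqVlt; apply/orP; left; apply/eqP; field.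
Qed.

Lemma sub1_pow7_le (X : rat) : 1 <= X ->
  (X - 1) ^+ 7 <= X ^+ 7 - 7 * X ^+ 6 + 21 * X ^+ 5.
Proof.
move=> X1; have h3 : 0 <= X ^+ 3 * (X - 1) by rewrite mulr_ge0 ?exprn_ge0 //; lra.
have h1 : 0 <= X * (X - 1) by rewrite mulr_ge0 //; lra.
by lra.
Qed.

Lemma head_lin_le n k rho : rho = (3 / 5) ^+ 5 -> (300 <= n)%N -> (0 < k)%N ->
  5 * pq n <= (3 / 2 * k%:R) * dq n ->
  \sum_(1 <= j < k.+1) j%:R * pq (n + k - j) <= pq (n + k) *
  ((25 / 4 * k%:R ^+ 2 - rho * (51 / 4 * k%:R ^+ 2 - 21 * k%:R)) / 42).
Proof.
move=> rhoE n300 k0 start; have PN0 := pq_gt0 (n + k).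
have [c cE] : exists c : rat, c = (5 / 2 * k%:R) ^+ 5 by eexists.
have c0 : 0 < c by rewrite cE scaled_pow5_gt0.
have ratio j : (j <= k)%N -> pq (n + k - j) * c <= pq (n + k) * (5 / 2 * k%:R - j%:R) ^+ 5.
  by rewrite cE; exact: pq_scaled_ratio n300 k0 start.
apply: (ler_of_pM2r c0); rewrite mulr_suml.
apply: (@le_trans _ _ (pq (n + k) * \sum_(1 <= j < k.+1) j%:R * (5 / 2 * k%:R - j%:R) ^+ 5)).
  rewrite mulr_sumr; apply: ler_sum_nat => j /andP[_ jk].
  rewrite -[leLHS]mulrA [leRHS]mulrCA; apply: ler_wpM2l; first by rewrite ler0n.
  exact: ratio.
rewrite -[leRHS]mulrA (ler_pM2l PN0).
have K1 : 1 <= k%:R :> rat by rewrite ler1n.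
have kY : k%:R <= 5 / 2 * k%:R :> rat by clear -K1; lra.
apply: le_trans (sum_lin_pow5_le kY) _; rewrite {}cE; move: K1 {kY start PN0 ratio c0}; move: (k%:R) => K K1.
have [X XE] : exists X, X = 3 / 2 * K by eexists.
have -> : 5 / 2 * K - K = X by rewrite XE; field.
have X1 : 1 <= X by rewrite XE; clear -K1; lra.
have pow7 := sub1_pow7_le X1.
have K0 : 0 <= K by clear -K1; lra.
have h := ler_wpM2l K0 pow7.
apply: (@le_trans _ _ (((5 / 2 * K) ^+ 7 - (K + 1) * X ^+ 7 +
   K * (X ^+ 7 - 7 * X ^+ 6 + 21 * X ^+ 5)) / 42)).
  by clear -h; lra.
by rewrite le_eqVlt; apply/orP; left; apply/eqP; rewrite XE rhoE; field.
Qed.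

Lemma head_le n k rho : rho = (3 / 5) ^+ 5 -> (300 <= n)%N -> (0 < k)%N ->
  5 * pq n <= (3 / 2 * k%:R) * dq n ->
  \sum_(1 <= j < k.+1) pq (n + k - j) <= pq (n + k) *
  ((5 / 2 - 3 / 2 * rho) * k%:R / 6).
Proof.
move=> rhoE n300 k0 start; have PN0 := pq_gt0 (n + k).
have [c cE] : exists c : rat, c = (5 / 2 * k%:R) ^+ 5 by eexists.
have c0 : 0 < c by rewrite cE scaled_pow5_gt0.
have ratio j : (j <= k)%N -> pq (n + k - j) * c <= pq (n + k) * (5 / 2 * k%:R - j%:R) ^+ 5.
  by rewrite cE; exact: pq_scaled_ratio n300 k0 start.
apply: (ler_of_pM2r c0); rewrite mulr_suml.
apply: (@le_trans _ _ (pq (n + k) * \sum_(1 <= j < k.+1) (5 / 2 * k%:R - j%:R) ^+ 5)).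
  by rewrite mulr_sumr; apply: ler_sum_nat => j /andP[_ jk]; apply: ratio.
rewrite -[leRHS]mulrA (ler_pM2l PN0).
have K1 : 1 <= k%:R :> rat by rewrite ler1n.
have kY : k%:R <= 5 / 2 * k%:R :> rat by clear -K1; lra.
apply: le_trans (sum_pow5_le kY) _; rewrite {}cE; move: {start PN0 K1 kY ratio c0}(k%:R) => K.
by rewrite le_eqVlt; apply/orP; left; apply/eqP; rewrite rhoE; field.
Qed.

Lemma sum_shift_split (f : nat -> rat) n k :
  \sum_(1 <= j < (n + k).+1) f j =
  \sum_(1 <= j < k.+1) f j + \sum_(1 <= i < n.+1) f (k + i)%N.
Proof.
elim: n => [|n IH]; first by rewrite add0n [X in _ + X]big_geq ?addr0.
rewrite addSn big_nat_recr //= IH [X in _ = _ + X]big_nat_recr //= addrA.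
by rewrite addnS addnC.
Qed.

(** To leading order [n] is [0.45 K^2], while the left side is about [0.414 K^2]; [K >= 50] absorbs
    the lower-order terms. *)
Lemma final_numeric (n K L rho : rat) : rho = (3 / 5) ^+ 5 ->
  50 <= K -> 0 <= n -> L <= 2944 / 1000 + 118 / 1000 * K ->
  20 * (n + 1) + 24 * K <= 9 * K ^+ 2 ->
  9 * (K - 1) ^+ 2 <= 20 * (n + 1) + 24 * (K - 1) ->
  33 / 20 * ((25 / 4 * K ^+ 2 - rho * (51 / 4 * K ^+ 2 - 21 * K)) / 42 +
     rho * (2 * n + K ^+ 2 / 2)) +
  L / 2 * ((5 / 2 - 3 / 2 * rho) * K / 6 + rho * (n / K + K / 2)) < n + K.
Proof.
move=> rhoE K50 n0 L1 H1 H2.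
have K0 : 0 < K by clear -K50; lra.
have nK : n / K <= 9 / 20 * K by rewrite (ler_pdivrMr _ _ K0); clear -H1 K0; lra.
have nK0 : 0 <= n / K := divr_ge0 n0 (ltW K0).
move: nK nK0; move: (n / K) => q q1 q0.
have [B BE] : exists B, B = (5 / 2 - 3 / 2 * rho) * K / 6 + rho * (q + K / 2) by eexists.
have B0 : 0 <= B by rewrite BE rhoE; clear -K0 q0; lra.
have B1 : B <= 4724 / 10000 * K by rewrite BE rhoE; clear -K0 q1; lra.
rewrite -BE rhoE {BE}.
have h1 := ler_wpM2r B0 L1.
have c0 : 0 <= 2944 / 1000 + 118 / 1000 * K by clear -K0; lra.
have h2 := ler_wpM2l c0 B1.
have h3 : 0 <= K * (K - 50) by apply: mulr_ge0; clear -K50; lra.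
by clear -h1 h2 h3 H1 H2 K50; lra.
Qed.

Lemma weighted_tail_sums n k : (0 < k <= n)%N ->
  \sum_(1 <= i < n.+1) (k + i)%:R * pq (n - i) <= (2 * n%:R + k%:R ^+ 2 / 2) * pq n /\
  \sum_(1 <= i < n.+1) pq (n - i) <= (n%:R / k%:R + k%:R / 2) * pq n.
Proof.
move=> /andP[k0 kn]; have kq : 0 < k%:R :> rat by rewrite ltr0n.
have kq0 : k%:R != 0 :> rat by rewrite gt_eqF.
have G1 := sum_pq_le kn; have G2 := sum_lin_pq_le n; split.
  under eq_bigr => i _ do rewrite natrD mulrDl.
  rewrite big_split /= -mulr_sumr.
  have -> : (2 * n%:R + k%:R ^+ 2 / 2) * pq n = (n%:R + k%:R ^+ 2 / 2) * pq n + n%:R * pq n.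
    by ring.
  exact: lerD G1 G2.
rewrite -(ler_pM2l kq); apply: le_trans G1 _.
by rewrite le_eqVlt; apply/orP; left; apply/eqP; field.
Qed.

Lemma scale_bounds n k : (50 <= k)%N -> (20 * n.+1 + 24 * k <= 9 * (k * k))%N ->
  (9 * (k.-1 * k.-1) < 20 * n.+1 + 24 * k.-1)%N ->
  [/\ (k <= n)%N, (8 * k <= n + k)%N,
     20 * (n%:R + 1) + 24 * k%:R <= 9 * k%:R ^+ 2 :> rat &
     9 * (k%:R - 1) ^+ 2 <= 20 * (n%:R + 1) + 24 * (k%:R - 1) :> rat].
Proof.
move=> k50 kn1 kn2.
have k2 : (49 * k.-1 <= k.-1 * k.-1)%N by rewrite leq_mul2r; lia.
split; [lia | lia | |].
  by move: kn1; rewrite -(ler_nat rat) natrD !natrM -(natr1 n) expr2.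
have kE : k.-1%:R = k%:R - 1 :> rat by rewrite -subn1 natrB //; lia.
by move: (ltnW kn2); rewrite -(ler_nat rat) natrD !natrM -(natr1 n) kE expr2.
Qed.

Lemma harmonic_like_bound n k : (50 <= k)%N -> (8 * k <= n + k)%N ->
  20 * (n%:R + 1) + 24 * k%:R <= 9 * k%:R ^+ 2 :> rat ->
  \sum_(1 <= a < (n + k).+1) (a%:R - 1) / a%:R ^+ 2 <= 2944 / 1000 + 118 / 1000 * k%:R :> rat.
Proof.
move=> k50 kn H; have k16 : (16 <= k)%N by lia.
apply: le_trans (sum_pred_div_sqr_le k16 kn) _.
have K50 : 50 <= k%:R :> rat by rewrite ler_nat.
have k0 : 0 < k%:R :> rat by clear -K50; lra.
have [x xE] : exists x : rat, x = (n + k)%:R / k%:R by eexists.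
(* The linear coefficient is then [8/130 + 9/160 < 118/1000], and the constant is
   [4927/1000 - 128/130 - 1 < 2944/1000]. *)
have q : x <= 9 / 20 * k%:R.
  by rewrite xE (ler_pdivrMr _ _ k0) natrD; clear -H K50; lra.
suff : 4927 / 1000 + (8 * k%:R - 128) / 130 + (x - 8) / 8 <= 2944 / 1000 + 118 / 1000 * k%:R.
  by rewrite xE.
by clear -q K50; lra.
Qed.

Lemma pq_weighted_sum_split_le n k :
  (n + k)%:R * pq (n + k) <=
  (\sum_(1 <= a < (n + k).+1) a%:R ^- 2) *
    (\sum_(1 <= j < k.+1) j%:R * pq (n + k - j) +
     \sum_(1 <= i < n.+1) (k + i)%:R * pq (n - i)) +
  (\sum_(1 <= a < (n + k).+1) (a%:R - 1) / a%:R ^+ 2) / 2 *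
    (\sum_(1 <= j < k.+1) pq (n + k - j) + \sum_(1 <= i < n.+1) pq (n - i)).
Proof.
apply: le_trans (pq_weighted_sum_le (n + k)) _.
have tailE i : (n + k - (k + i))%N = (n - i)%N by lia.
have -> : \sum_(1 <= j < (n + k).+1) j%:R * pq (n + k - j) =
    \sum_(1 <= j < k.+1) j%:R * pq (n + k - j) +
    \sum_(1 <= i < n.+1) (k + i)%:R * pq (n - i).
  rewrite (sum_shift_split (fun j => j%:R * pq (n + k - j))); congr (_ + _).
  by apply: eq_bigr => i _; rewrite tailE.
have -> : \sum_(1 <= j < (n + k).+1) pq (n + k - j) =
    \sum_(1 <= j < k.+1) pq (n + k - j) + \sum_(1 <= i < n.+1) pq (n - i).
  rewrite (sum_shift_split (fun j => pq (n + k - j))); congr (_ + _).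
  by apply: eq_bigr => i _; rewrite tailE.
exact: lexx.
Qed.

Lemma weighted_sum_contradiction (N rho PN Pn A1 A0 c1 c0 h1 h0 t1 t0 L Z : rat) :
  0 < PN -> Pn <= rho * PN -> 0 <= c1 -> 0 <= c0 -> 0 <= h1 + t1 ->
  h1 <= PN * A1 -> h0 <= PN * A0 -> t1 <= c1 * Pn -> t0 <= c0 * Pn ->
  0 <= L -> Z <= 33 / 20 ->
  33 / 20 * (A1 + rho * c1) + L / 2 * (A0 + rho * c0) < N ->
  N * PN <= Z * (h1 + t1) + L / 2 * (h0 + t0) -> False.
Proof.
move=> PN0 PnP c10 c00 ht0 h1P h0P t1P t0P L0 ZP fin.
apply/negP; rewrite -ltNge.
have e1 : h1 + t1 <= PN * (A1 + rho * c1).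
  by have := ler_wpM2l c10 PnP; clear -h1P t1P; lra.
have e0 : h0 + t0 <= PN * (A0 + rho * c0).
  by have := ler_wpM2l c00 PnP; clear -h0P t0P; lra.
have L20 : 0 <= L / 2 by clear -L0; lra.
have g1 := ler_wpM2r ht0 ZP; have g0 := ler_wpM2l L20 e0.
have f := fin; rewrite -(ltr_pM2r PN0) in f.
by clear -e1 g1 g0 f; lra.
Qed.

Lemma p_near_log_convex_large n : (1021 <= n)%N ->
  n%:R * pq n ^+ 2 < n.+1%:R * (pq n.-1 * pq n.+1).
Proof.
move=> n1021; rewrite ltNge; apply/negP => fail.
have [k [k50 kn1 kn2]] := scale_exists n1021.
have [kn kN H1 H2] := scale_bounds k50 kn1 kn2.
have K50 : 50 <= k%:R :> rat by rewrite ler_nat.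
have k0 : (0 < k)%N by lia.
have N2 : (2 <= n + k)%N by lia.
have n300 : (300 <= n)%N by lia.
have n301 : (301 <= n)%N by lia.
have X4 : 4 < 3 / 2 * k%:R :> rat by clear -K50; lra.
have XE : 5 * n.+1%:R <= 3 / 2 * k%:R * (3 / 2 * k%:R - 4) :> rat.
  by rewrite -(natr1 n); clear -H1; lra.
have start := turan_start n301 fail X4 XE.
have [rho rhoE] : exists rho : rat, rho = (3 / 5) ^+ 5 by eexists.
have Pn := pq_start_le n300 k0 start; rewrite -rhoE in Pn.
have h1 := head_lin_le rhoE n300 k0 start; have h0 := head_le rhoE n300 k0 start.
have kn' : (0 < k <= n)%N by rewrite k0.
have [t1 t0] := weighted_tail_sums kn'.
have L1 := harmonic_like_bound k50 kN H1.
have Z1 := sum_inv_sqr_le N2.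
have fin := final_numeric rhoE K50 (ler0n rat n) L1 H1 H2.
have W := pq_weighted_sum_split_le n k.
have L0 : 0 <= \sum_(1 <= a < (n + k).+1) (a%:R - 1) / a%:R ^+ 2 :> rat.
  rewrite big_nat; apply: sumr_ge0 => a /andP[a1 _].
  by apply: divr_ge0; [rewrite subr_ge0 ler1n | rewrite exprn_ge0 ?ler0n].
have Z33 : \sum_(1 <= a < (n + k).+1) a%:R ^- 2 <= 33 / 20 :> rat.
  apply: le_trans Z1 _; rewrite gerBl invr_ge0; apply: addr_ge0; first exact: ler0n.
  by clear; lra.
have c1 : 0 <= 2 * n%:R + k%:R ^+ 2 / 2 :> rat.
  have := ler0n rat n; have := exprn_ge0 2 (ler0n rat k); clear; lra.
have c0 : 0 <= n%:R / k%:R + k%:R / 2 :> rat.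
  have := divr_ge0 (ler0n rat n) (ler0n rat k); have := ler0n rat k; clear; lra.
have ht : 0 <= \sum_(1 <= j < k.+1) j%:R * pq (n + k - j) +
    \sum_(1 <= i < n.+1) (k + i)%:R * pq (n - i).
  apply: addr_ge0; apply: sumr_ge0 => i _; exact: mulr_ge0 (ler0n _ _) (ltW (pq_gt0 _)).
rewrite natrD in W.
exact: weighted_sum_contradiction (pq_gt0 (n + k)) Pn c1 c0 ht h1 h0 t1 t0 L0 Z33 fin W.
Qed.

Lemma p_near_log_convex n : (1 < n)%N ->
  n%:R * (p n)%:R ^+ 2 < n.+1%:R * ((p n.-1)%:R * (p n.+1)%:R) :> rat.
Proof.
move=> n1; case: (ltnP n 1021) => n1021; last exact: p_near_log_convex_large.
have n0 : (0 < n < 1021)%N by rewrite (ltnW n1).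
by have := p_near_log_convex_small n0; rewrite -(ltr_nat rat) !natrM expr2.
Qed.

Theorem theorem4p1 (n : nat) : (1 < n)%N ->
  (p n)%:R / (p n.+1)%:R < (p n.-1)%:R / (p n)%:R * (1 + 1 / n%:R) :> rat.
Proof.
move=> n1; have H := p_near_log_convex n1.
have n0 : 0 < n%:R :> rat by rewrite ltr0n ltnW.
have p0 i : 0 < (p i)%:R :> rat by rewrite ltr0n p_gt0.
have nz : n%:R != 0 :> rat by rewrite gt_eqF.
have pz i : (p i)%:R != 0 :> rat by rewrite gt_eqF.
have -> : 1 + 1 / n%:R = n.+1%:R / n%:R :> rat by rewrite -(natr1 n); field.
rewrite mulf_div (ltr_pdivrMr _ _ (p0 n.+1)) -mulrAC (ltr_pdivlMr _ _ (mulr_gt0 (p0 n) n0)).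
by move: H; move: (p n)%:R (p n.-1)%:R (p n.+1)%:R (n%:R) (n.+1%:R) => *; lra.
Qed.
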